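(* Let $\mathbb{V}^{m\times n}$ ($m\le n$) be the space of $m\times n$ real (or complex) matrices, let $\mathcal{N}\subseteq\mathbb{V}^{m\times n}$ be a nonempty open set, let $g:\mathbb{R}^m\to\mathbb{R}^m$ be absolutely symmetric on an open set $\hat{\sigma}_{\mathcal N}\subseteq\mathbb{R}^m$ containing $\sigma_{\mathcal N}=\{\sigma(X)\mid X\in\mathcal{N}\}$, and let $G:\mathcal{N}\to\mathbb{V}^{m\times n}$ be the spectral operator with respect to $g$. Let $\overline{X}\in\mathcal{N}$ have the singular value decomposition $\overline{X}=\overline{U}\,[\Sigma(\overline{X})\ \ 0]\,\overline{V}^{\mathsf T}$, and let $0<\rho\le 1$ be given. (i) If $g$ is locally Lipschitz continuous near $\sigma(\overline{X})$ and $\rho$-order B-differentiable at $\sigma(\overline{X})$, then $G$ is $\rho$-order B-differentiable at $\overline{X}$. (ii) If $G$ is $\rho$-order B-differentiable at $\overline{X}$, then $g$ is $\rho$-order B-differentiable at $\sigma(\overline{X})$.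
   Context: $\mathbb{V}^{m\times n}$ is regarded as a real Euclidean vector space with the Frobenius norm $\|\cdot\|$ (inner product $\mathrm{Re}\,\mathrm{tr}(X^{\mathsf T}Y)$, where $^{\mathsf T}$ means transpose in the real case and conjugate transpose in the complex case). For $X\in\mathbb{V}^{m\times n}$, $\sigma(X)=(\sigma_1(X),\ldots,\sigma_m(X))\in\mathbb{R}^m$ is the vector of singular values with $\sigma_1(X)\ge\cdots\ge\sigma_m(X)\ge 0$, $\Sigma(X)=\mathrm{Diag}(\sigma(X))$ is the $m\times m$ diagonal matrix with these entries, and $\mathbb{O}^{m,n}(X)$ is the set of all pairs $(U,V)$ of $m\times m$ and $n\times n$ orthogonal (unitary in the complex case) matrices with $X=U[\Sigma(X)\ \ 0]V^{\mathsf T}$; in the singular value decomposition of $\overline X$, $(\overline U,\overline V)\in\mathbb{O}^{m,n}(\overline X)$. Let $\pm\mathbb{P}^m$ be the set of $m\times m$ signed permutation matrices (exactly one nonzero entry, equal to $\pm1$, in each row and each column). The mapping $g:\mathbb{R}^m\to\mathbb{R}^m$ is absolutely symmetric (mixed symmetric with respect to $\pm\mathbb{P}^m$) on a set $\mathcal{D}\subseteq\mathbb{R}^m$ if $g(Qx)=Qg(x)$ for all $Q\in\pm\mathbb{P}^m$ and all $x\in\mathcal{D}$. The spectral operator $G:\mathcal{N}\to\mathbb{V}^{m\times n}$ with respect to $g$ is defined by $G(X)=U[\mathrm{Diag}(g(\sigma(X)))\ \ 0]V^{\mathsf T}$, $X\in\mathcal{N}$, where $(U,V)\in\mathbb{O}^{m,n}(X)$;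 by the absolute symmetry of $g$ this does not depend on the choice of $(U,V)$. A map is locally Lipschitz continuous near a point if it is Lipschitz continuous on some open neighborhood of that point. Let $\mathcal{Z},\mathcal{Z}'$ be finite dimensional real Euclidean spaces and $\mathcal{O}\subseteq\mathcal{Z}$ open. For $\rho>0$, a function $F:\mathcal{O}\to\mathcal{Z}'$ is $\rho$-order B(ouligand)-differentiable at $z\in\mathcal{O}$ if the directional derivative $F'(z;h)=\lim_{t\downarrow 0}\frac{F(z+th)-F(z)}{t}$ exists for every $h\in\mathcal{Z}$ and, as $h\to0$, $F(z+h)-F(z)-F'(z;h)=O(\|h\|^{1+\rho})$. *)

(* Defs.v *)
From HB Require Import structures.
From mathcomp Require Import all_boot all_order all_algebra.
From mathcomp Require Import complex.
From mathcomp Require Import all_classical all_reals all_analysis.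

Set Implicit Arguments.
Unset Strict Implicit.
Unset Printing Implicit Defensive.

Import Order.TTheory GRing.Theory Num.Theory.
Import numFieldNormedType.Exports.

Local Open Scope classical_set_scope.
Local Open Scope ring_scope.

(* The matrix entries range over [K], which is either [R] itself or [R[i]].
   Case analysis on an inhabitant of this family replaces [K] by one of the two
   fields. The space R^m is the case [K = R] of ['cV[K]_m]. *)
Inductive real_or_complex (R : realType) : numFieldType -> Type :=
| RealField : real_or_complex R R
| ComplexField : real_or_complex R R[i].

Arguments RealField {R}.
Arguments ComplexField {R}.

Definition of_real (R : realType) (K : numFieldType)
    (S : real_or_complex R K) : R -> K :=
  match S in real_or_complex _ K0 return R -> K0 with
  | RealField => fun x => x
  | ComplexField => fun x => real_complex R x
  end.

Definition re_part (R : realType) (K : numFieldType)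
    (S : real_or_complex R K) : K -> R :=
  match S in real_or_complex _ K0 return K0 -> R with
  | RealField => fun x => x
  | ComplexField => fun z => complex.Re z
  end.

Definition conj_scalar (R : realType) (K : numFieldType)
    (S : real_or_complex R K) : K -> K :=
  match S in real_or_complex _ K0 return K0 -> K0 with
  | RealField => fun x => x
  | ComplexField => fun z => conjc z
  end.

Section Matrices.
Variables (R : realType) (K : numFieldType) (S : real_or_complex R K).

Definition adjoint (m n : nat) (A : 'M[K]_(m, n)) : 'M[K]_(n, m) :=
  (map_mx (conj_scalar S) A)^T.

Definition frob_inner (m n : nat) (A B : 'M[K]_(m, n)) : R :=
  re_part S (\tr (adjoint A *m B)).

Definition frob_norm (m n : nat) (A : 'M[K]_(m, n)) : R :=
  Num.sqrt (frob_inner A A).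

Definition unitary (n : nat) (U : 'M[K]_n) : Prop := U *m adjoint U = 1%:M.

(* The m x n matrix [Diag(x) 0]; for m <= n no entry of [x] is lost. *)
Definition diag_block (m n : nat) (x : 'cV[R]_m) : 'M[K]_(m, n) :=
  \matrix_(i, j) (of_real S (x i ord0) *+ (i == j :> nat)).

(* The squares of the singular values of [X] are the eigenvalues, counted with
   multiplicity, of X X^*. *)
Definition is_singular_values (m n : nat) (X : 'M[K]_(m, n)) (s : 'cV[R]_m) :
    Prop :=
  [/\ forall i, 0 <= s i ord0,
      forall i j : 'I_m, (i <= j)%N -> s j ord0 <= s i ord0
    & char_poly (X *m adjoint X)
        = \prod_(i < m) ('X - ((of_real S (s i ord0)) ^+ 2)%:P)].

(* [is_singular_values X] holds of exactly one vector, because X X^* is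
   Hermitian positive semidefinite; the default [0] is never used. *)
Definition sigma (m n : nat) (X : 'M[K]_(m, n)) : 'cV[R]_m :=
  xget 0 [set s | is_singular_values X s].

Definition svd_pairs (m n : nat) (X : 'M[K]_(m, n)) :
    set ('M[K]_m * 'M[K]_n) :=
  [set UV | [/\ unitary UV.1, unitary UV.2
    & X = UV.1 *m diag_block n (sigma X) *m adjoint UV.2]].

(* The pair is picked in [svd_pairs X], which is nonempty for m <= n. When [g]
   is absolutely symmetric on a set containing [sigma X], the result does not
   depend on the pair. *)
Definition spectral_operator (m n : nat) (g : 'cV[R]_m -> 'cV[R]_m)
    (X : 'M[K]_(m, n)) : 'M[K]_(m, n) :=
  let UV := xget (1%:M, 1%:M) (svd_pairs X) in
  UV.1 *m diag_block n (g (sigma X)) *m adjoint UV.2.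

(* A function on an open set is represented by any total extension: every
   notion below only involves its values near [z]. Open sets and limits refer
   to the library topology on matrices (entrywise convergence), which is the
   topology of the Frobenius norm. *)
Section Differentiability.
Variables (m n p q : nat) (F : 'M[K]_(m, n) -> 'M[K]_(p, q)).

Definition diff_quotient (z h : 'M[K]_(m, n)) (t : R) : 'M[K]_(p, q) :=
  of_real S t^-1 *: (F (z + of_real S t *: h) - F z).

Definition dir_derivable (z h : 'M[K]_(m, n)) : Prop :=
  cvg (diff_quotient z h t @[t --> 0^'+]).

Definition dir_derivative (z h : 'M[K]_(m, n)) : 'M[K]_(p, q) :=
  lim (diff_quotient z h t @[t --> 0^'+]).

Definition B_differentiable (rho : R) (z : 'M[K]_(m, n)) : Prop :=
  (forall h, dir_derivable z h) /\
  exists C : R, \forall h \near (0 : 'M[K]_(m, n)),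
    frob_norm (F (z + h) - F z - dir_derivative z h)
      <= C * frob_norm h `^ (1 + rho).

Definition locally_lipschitz_near (z : 'M[K]_(m, n)) : Prop :=
  exists (W : set 'M[K]_(m, n)) (L : R),
    [/\ open W, W z
      & forall x y, W x -> W y ->
          frob_norm (F x - F y) <= L * frob_norm (x - y)].

End Differentiability.
End Matrices.

Definition signed_perm_mx (R : realType) (m : nat) (Q : 'M[R]_m) : Prop :=
  [/\ forall i j, Q i j \in [:: 0; 1; -1],
      forall i, exists! j, Q i j != 0
    & forall j, exists! i, Q i j != 0].

Definition absolutely_symmetric (R : realType) (m : nat) (D : set 'cV[R]_m)
    (g : 'cV[R]_m -> 'cV[R]_m) : Prop :=
  forall Q : 'M[R]_m, signed_perm_mx Q ->
  forall x, D x -> g (Q *m x) = Q *m g x.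

(* Main.v *)
Require Import Defs.
From HB Require Import structures.
From mathcomp Require Import all_boot all_order all_algebra.
From mathcomp Require Import fingroup perm complex.
From mathcomp Require Import all_classical all_reals all_analysis.
From mathcomp Require Import ring lra.

Set Implicit Arguments.
Unset Strict Implicit.
Unset Printing Implicit Defensive.

Import Order.TTheory GRing.Theory Num.Theory.
Import numFieldNormedType.Exports.

Local Open Scope classical_set_scope.
Local Open Scope ring_scope.

(* A matrix H decomposes, relative to X, as H = A X - X B + Delta with A, B
   skew-Hermitian and Delta sharing a singular value decomposition with X:
   X = W [sigma] Z^*, Delta = W [e] Z^* (solve a Sylvester equation between
   distinct singular values, keep the Hermitian part inside each cluster). If P
   and Q are the Cayley transforms of A and B, then X + H and P (X + Delta) Q^*
   differ by O(|H|^2). At the second point G is known exactly, namely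
   P W [g(sigma + e)] Z^* Q^*, and G is Lipschitz near X, so
     G(X + H) = G(X) + A G(X) - G(X) B + W [g(sigma + e) - g(sigma)] Z^* + O(|H|^2).
   Inserting the expansion of g gives both the directional derivative and the
   remainder. The Lipschitz bound, a crude form of Weyl's inequality and the
   independence of G from the chosen decomposition all follow from comparing the
   entries of two decompositions in the frame (U'^* U, V'^* V). Conversely, g is
   the composition of G with the linear map y |-> U [y] V^* and the linear map
   reading off the diagonal of U^* M V. *)

(** * Scalars and matrix norms *)

(** Singular vectors cannot be differentiated where singular values coincide or vanish. So W and Z,
    hence also e, may change with H; only the bounds on A, B and e have to be uniform in H, and for
    this reason no constant below depends on the unitary factors. The entries of e carry arbitrary
    signs and order: sigma + e need not be the vector of singular values of X + Delta, but absolute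
    symmetry still evaluates G there. For t > 0, the matrix tH decomposes as tA, tB, te with the
    same W and Z, so one decomposition of H yields both the candidate derivative A G(X) - G(X) B + W
    [g'(sigma; e)] Z^* and the remainder. The error |H|^2 is absorbed by |H|^(1 + rho) because rho
    <= 1 and |H| < 1. Apart from facts about scalars, real matrices are treated through complex ones
    only once, to find a common eigenvector of two commuting Hermitian matrices. *)

Section Scalars.
Variables (R : realType) (K : numFieldType) (S : real_or_complex R K).

Lemma of_real_is_zmod_morphism : zmod_morphism (of_real S).
Proof. by case: S => x y //=; rewrite rmorphB. Qed.

Lemma of_real_is_monoid_morphism : monoid_morphism (of_real S).
Proof. by case: S; split => // x y; rewrite /= rmorphM. Qed.

HB.instance Definition _ :=
  GRing.isZmodMorphism.Build R K (of_real S) of_real_is_zmod_morphism.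
HB.instance Definition _ :=
  GRing.isMonoidMorphism.Build R K (of_real S) of_real_is_monoid_morphism.

Lemma conj_is_zmod_morphism : zmod_morphism (conj_scalar S).
Proof. by case: S => x y //=; rewrite rmorphB. Qed.

Lemma conj_is_monoid_morphism : monoid_morphism (conj_scalar S).
Proof.
by case: S; split => [|x y] //=; rewrite ?rmorphM // oppr0.
Qed.

HB.instance Definition _ :=
  GRing.isZmodMorphism.Build K K (conj_scalar S) conj_is_zmod_morphism.
HB.instance Definition _ :=
  GRing.isMonoidMorphism.Build K K (conj_scalar S) conj_is_monoid_morphism.

Lemma re_part_is_zmod_morphism : zmod_morphism (re_part S).
Proof. by case: S => //= -[a b] [c d]. Qed.

HB.instance Definition _ :=
  GRing.isZmodMorphism.Build K R (re_part S) re_part_is_zmod_morphism.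

Lemma of_realK : cancel (of_real S) (re_part S).
Proof. by case: S. Qed.

Lemma of_real_inj : injective (of_real S).
Proof. exact: can_inj of_realK. Qed.

Lemma ler_of_real (x y : R) : (of_real S x <= of_real S y) = (x <= y).
Proof. by case: S => //=; rewrite lecR. Qed.

Lemma ltr_of_real (x y : R) : (of_real S x < of_real S y) = (x < y).
Proof. by case: S => //=; rewrite ltcR. Qed.

Lemma conj_scalarK : involutive (conj_scalar S).
Proof. by case: S => //= x; rewrite conjcK. Qed.

Lemma conj_of_real (x : R) : conj_scalar S (of_real S x) = of_real S x.
Proof. by case: S => //=; rewrite oppr0. Qed.

(** Balls in [K] have radii in [K]. In [R[i]] comparable numbers have equal imaginary parts, so a
    positive radius is real. *)
Lemma gt0_of_real (e : K) : 0 < e -> exists2 e' : R, 0 < e' & e = of_real S e'.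
Proof.
case: S e => [e e0|[a b]]; first by exists e.
by rewrite ltcE /= => /andP[/eqP -> a0]; exists a.
Qed.

(* The modulus of a scalar, as an element of [R] rather than of [K]. *)
Definition modulus (z : K) : R := re_part S `|z|.

Lemma of_real_modulus (z : K) : of_real S (modulus z) = `|z|.
Proof. by rewrite /modulus; case: S z => //= z; rewrite normc_def. Qed.

Lemma modulus_ge0 (z : K) : 0 <= modulus z.
Proof. by rewrite -ler_of_real of_real_modulus rmorph0. Qed.

Lemma modulusM (x y : K) : modulus (x * y) = modulus x * modulus y.
Proof. by apply: of_real_inj; rewrite rmorphM /= !of_real_modulus normrM. Qed.

Lemma modulusV (x : K) : modulus x^-1 = (modulus x)^-1.
Proof. by apply: of_real_inj; rewrite fmorphV /= !of_real_modulus normfV. Qed.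

Lemma ler_modulusD (x y : K) : modulus (x + y) <= modulus x + modulus y.
Proof. by rewrite -ler_of_real rmorphD /= !of_real_modulus ler_normD. Qed.

Lemma modulusN (x : K) : modulus (- x) = modulus x.
Proof. by rewrite /modulus normrN. Qed.

Lemma modulus0 : modulus 0 = 0.
Proof. by rewrite /modulus normr0 raddf0. Qed.

Lemma modulus0_eq0 (z : K) : (modulus z == 0) = (z == 0).
Proof.
by rewrite -(inj_eq of_real_inj) of_real_modulus rmorph0 normr_eq0.
Qed.

Lemma modulus_of_real (x : R) : modulus (of_real S x) = `|x|.
Proof.
by rewrite /modulus; case: S => //=; rewrite expr0n /= addr0 sqrtr_sqr.
Qed.

Lemma modulus_conj (z : K) : modulus (conj_scalar S z) = modulus z.
Proof. by rewrite /modulus; case: S z => [z|z] //; congr (complex.Re _); exact: normcJ. Qed.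

Lemma mul_conj (z : K) : z * conj_scalar S z = of_real S (modulus z ^+ 2).
Proof.
rewrite rmorphXn /= of_real_modulus; case: S z => [z|z] /=.
  by rewrite real_normK ?num_real // expr2.
by rewrite sqr_normc.
Qed.

Lemma re_part_le_modulus (z : K) : `|re_part S z| <= modulus z.
Proof.
rewrite -ler_of_real of_real_modulus; case: S z => //= z.
exact: normc_ge_Re.
Qed.

Lemma re_part_mul_of_real (x : R) (z : K) :
  re_part S (of_real S x * z) = x * re_part S z.
Proof. by case: S z => //= -[a b] /=; rewrite mul0r subr0. Qed.

Lemma ler_modulus_sum (I : Type) (r : seq I) (P : pred I) (f : I -> K) :
  modulus (\sum_(i <- r | P i) f i) <= \sum_(i <- r | P i) modulus (f i).
Proof.
elim/big_rec2: _ => [|i y x _ xy]; first by rewrite modulus0.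
by apply: le_trans (ler_modulusD _ _) _; rewrite lerD2l.
Qed.

End Scalars.

Section Norm.
Variables (R : realType) (K : numFieldType) (S : real_or_complex R K).
Local Notation "A ^*h" := (adjoint S A) (at level 8, format "A ^*h").

(* Every estimate is carried out in this norm, which is trivially
   submultiplicative and equivalent to the Frobenius norm; constants are
   irrelevant for B-differentiability. *)
Definition l1norm (m n : nat) (A : 'M[K]_(m, n)) : R :=
  \sum_i \sum_j modulus S (A i j).
Local Notation "`[ A ]" := (l1norm A) (at level 0, A at level 99).

Lemma l1norm_ge0 m n (A : 'M[K]_(m, n)) : 0 <= `[A].
Proof. by do 2![apply: sumr_ge0 => ? _]; rewrite modulus_ge0. Qed.

Lemma l1norm0 m n : `[0 : 'M[K]_(m, n)] = 0.
Proof. by rewrite /l1norm; do 2![apply: big1 => ? _]; rewrite mxE modulus0. Qed.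

Lemma l1norm_entry m n (A : 'M[K]_(m, n)) i j : modulus S (A i j) <= `[A].
Proof.
rewrite /l1norm (bigD1 i) //= (bigD1 j) //= -addrA lerDl addr_ge0 //.
  by apply: sumr_ge0 => ? _; rewrite modulus_ge0.
by do 2![apply: sumr_ge0 => ? _]; rewrite modulus_ge0.
Qed.

Lemma l1norm_eq0 m n (A : 'M[K]_(m, n)) : `[A] = 0 -> A = 0.
Proof.
move=> A0; apply/matrixP => i j; rewrite mxE; apply/eqP.
rewrite -(modulus0_eq0 S) eq_le modulus_ge0 andbT -A0.
exact: l1norm_entry.
Qed.

Lemma l1norm_le m n (A : 'M[K]_(m, n)) (c : R) :
  (forall i j, modulus S (A i j) <= c) -> `[A] <= (m * n)%:R * c.
Proof.
move=> Ac; apply: le_trans (_ : \sum_(i < m) \sum_(j < n) c <= _).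
  by apply: ler_sum => i _; apply: ler_sum => j _; exact: Ac.
by rewrite !sumr_const !card_ord -mulrnA mulr_natl mulnC.
Qed.

Lemma ler_l1normD m n (A B : 'M[K]_(m, n)) : `[A + B] <= `[A] + `[B].
Proof.
rewrite /l1norm -big_split; apply: ler_sum => i _; rewrite -big_split.
by apply: ler_sum => j _; rewrite mxE ler_modulusD.
Qed.

Lemma l1normN m n (A : 'M[K]_(m, n)) : `[- A] = `[A].
Proof. by do 2![apply: eq_bigr => ? _]; rewrite mxE modulusN. Qed.

Lemma ler_l1normB m n (A B : 'M[K]_(m, n)) : `[A - B] <= `[A] + `[B].
Proof. by rewrite -[`[B]]l1normN ler_l1normD. Qed.

Lemma l1normBC m n (A B : 'M[K]_(m, n)) : `[A - B] = `[B - A].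
Proof. by rewrite -l1normN opprB. Qed.

Lemma l1norm_triangle m n (B A C : 'M[K]_(m, n)) :
  `[A - C] <= `[A - B] + `[B - C].
Proof. by rewrite -[A - C](subrKA B) ler_l1normD. Qed.

Lemma l1normZ m n (a : K) (A : 'M[K]_(m, n)) : `[a *: A] = modulus S a * `[A].
Proof.
rewrite /l1norm mulr_sumr; apply: eq_bigr => i _; rewrite mulr_sumr.
by apply: eq_bigr => j _; rewrite mxE modulusM.
Qed.

Lemma ler_l1normM m n p (A : 'M[K]_(m, n)) (B : 'M[K]_(n, p)) :
  `[A *m B] <= `[A] * `[B].
Proof.
rewrite /l1norm mulr_suml; apply: ler_sum => i _.
apply: le_trans (_ : \sum_j \sum_k modulus S (A i k) * modulus S (B k j) <= _).
  apply: ler_sum => j _; rewrite mxE; apply: le_trans (ler_modulus_sum _ _ _ _) _.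
  by apply: ler_sum => k _; rewrite modulusM.
rewrite exchange_big /= mulr_suml; apply: ler_sum => k _.
rewrite -mulr_sumr ler_wpM2l ?modulus_ge0 // (bigD1 k) //= lerDl.
by do 2![apply: sumr_ge0 => ? _]; rewrite modulus_ge0.
Qed.

Lemma adjointE m n (A : 'M[K]_(m, n)) i j : A^*h i j = conj_scalar S (A j i).
Proof. by rewrite !mxE. Qed.

Lemma adjointK m n (A : 'M[K]_(m, n)) : A^*h^*h = A.
Proof. by apply/matrixP => i j; rewrite !adjointE conj_scalarK. Qed.

Lemma adjointM m n p (A : 'M[K]_(m, n)) (B : 'M[K]_(n, p)) :
  (A *m B)^*h = B^*h *m A^*h.
Proof. by rewrite /adjoint map_mxM trmx_mul. Qed.

Lemma adjoint_is_zmod_morphism m n : zmod_morphism (@adjoint R K S m n).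
Proof. by move=> A B; rewrite /adjoint map_mxB linearB. Qed.

HB.instance Definition _ m n := GRing.isZmodMorphism.Build 'M[K]_(m, n)
  'M[K]_(n, m) (@adjoint R K S m n) (@adjoint_is_zmod_morphism m n).

Lemma adjointZ m n a (A : 'M[K]_(m, n)) :
  (a *: A)^*h = conj_scalar S a *: A^*h.
Proof. by rewrite /adjoint map_mxZ linearZ. Qed.

Lemma adjoint_scalar n a : (a%:M : 'M[K]_n)^*h = (conj_scalar S a)%:M.
Proof. by rewrite /adjoint map_scalar_mx tr_scalar_mx. Qed.

Lemma adjoint1 n : (1%:M : 'M[K]_n)^*h = 1%:M.
Proof. by rewrite /adjoint map_mx1 trmx1. Qed.

Lemma l1norm_adjoint m n (A : 'M[K]_(m, n)) : `[A^*h] = `[A].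
Proof.
rewrite /l1norm exchange_big; do 2![apply: eq_bigr => ? _].
by rewrite adjointE modulus_conj.
Qed.

Lemma unitaryC n (U : 'M[K]_n) : unitary S U -> U^*h *m U = 1%:M.
Proof. exact: mulmx1C. Qed.

Lemma unitary_adjoint n (U : 'M[K]_n) : unitary S U -> unitary S U^*h.
Proof. by move=> /unitaryC UU; rewrite /unitary adjointK. Qed.

Lemma unitaryM n (U V : 'M[K]_n) :
  unitary S U -> unitary S V -> unitary S (U *m V).
Proof.
move=> UU VV; rewrite /unitary adjointM mulmxA -(mulmxA U) VV mulmx1.
exact: UU.
Qed.

Lemma unitary1 n : unitary S (1%:M : 'M[K]_n).
Proof. by rewrite /unitary adjoint1 mulmx1. Qed.

Lemma unitary_row n (U : 'M[K]_n) i :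
  unitary S U -> \sum_j modulus S (U i j) ^+ 2 = 1.
Proof.
move=> /matrixP/(_ i i); rewrite !mxE eqxx => UU.
apply: (@of_real_inj _ _ S); rewrite rmorph_sum rmorph1 -[1]/(true%:R) -UU.
by apply: eq_bigr => j _; rewrite /= -mul_conj adjointE.
Qed.

Lemma unitary_col n (U : 'M[K]_n) j :
  unitary S U -> \sum_i modulus S (U i j) ^+ 2 = 1.
Proof.
move=> /unitary_adjoint/unitary_row -/(_ j) <-.
by apply: eq_bigr => i _; rewrite adjointE modulus_conj.
Qed.

Lemma unitary_entry n (U : 'M[K]_n) i j : unitary S U -> modulus S (U i j) <= 1.
Proof.
move=> UU; rewrite -(@ler_pXn2r _ 2) ?nnegrE ?modulus_ge0 // expr1n.
rewrite -(unitary_row i UU) (bigD1 j) //= lerDl.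
by apply: sumr_ge0 => k _; rewrite exprn_ge0 ?modulus_ge0.
Qed.

(** Each entry is a sum of terms U_il A_lk V_kj, bounded by the modulus of A_lk. The bound does not
    see U and V, which allows the singular vectors to vary freely with the perturbation. *)
Lemma unitary_mul_entry m n p q (U : 'M[K]_(p, m)) (A : 'M[K]_(m, n))
    (V : 'M[K]_(n, q)) i j :
  (forall i k, modulus S (U i k) <= 1) -> (forall k j, modulus S (V k j) <= 1) ->
  modulus S ((U *m A *m V) i j) <= `[A].
Proof.
move=> U1 V1; rewrite mxE; apply: le_trans (ler_modulus_sum _ _ _ _) _.
rewrite /l1norm exchange_big; apply: ler_sum => k _ /=.
rewrite modulusM (le_trans (ler_piMr _ (V1 _ _))) ?modulus_ge0 // mxE.
apply: le_trans (ler_modulus_sum _ _ _ _) _; apply: ler_sum => l _.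
by rewrite modulusM ler_piMl ?modulus_ge0.
Qed.

Lemma unitary_mul_l1norm m n (U : 'M[K]_m) (A : 'M[K]_(m, n)) (V : 'M[K]_n) :
  unitary S U -> unitary S V -> `[U *m A *m V] <= (m * n)%:R * `[A].
Proof.
move=> UU VV; apply: l1norm_le => i j; apply: unitary_mul_entry => ? ?;
  exact: unitary_entry.
Qed.

Lemma unitary_mulK m n (U : 'M[K]_m) (A : 'M[K]_(m, n)) (V : 'M[K]_n) :
  unitary S U -> unitary S V -> U *m (U^*h *m A *m V^*h) *m V = A.
Proof.
move=> UU VV; rewrite !mulmxA UU mul1mx -mulmxA (unitaryC VV) mulmx1 //.
Qed.

Lemma frob_normE m n (A : 'M[K]_(m, n)) :
  frob_norm S A = Num.sqrt (\sum_i \sum_j modulus S (A i j) ^+ 2).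
Proof.
rewrite /frob_norm /frob_inner /mxtrace; congr Num.sqrt.
rewrite raddf_sum exchange_big /=; apply: eq_bigr => j _.
rewrite mxE raddf_sum; apply: eq_bigr => i _ /=.
by rewrite adjointE mulrC mul_conj of_realK.
Qed.

Lemma frob_norm_ge0 m n (A : 'M[K]_(m, n)) : 0 <= frob_norm S A.
Proof. exact: sqrtr_ge0. Qed.

Lemma frob_norm_entry m n (A : 'M[K]_(m, n)) i j :
  modulus S (A i j) <= frob_norm S A.
Proof.
rewrite frob_normE -[leLHS]ger0_norm ?modulus_ge0 // -sqrtr_sqr.
rewrite ler_wsqrtr // (bigD1 i) //= (bigD1 j) //= -addrA lerDl addr_ge0 //.
  by apply: sumr_ge0 => ? _; rewrite exprn_ge0 ?modulus_ge0.
by do 2![apply: sumr_ge0 => ? _]; rewrite exprn_ge0 ?modulus_ge0.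
Qed.

Lemma l1norm_le_frob m n (A : 'M[K]_(m, n)) :
  `[A] <= (m * n)%:R * frob_norm S A.
Proof. by apply: l1norm_le => i j; exact: frob_norm_entry. Qed.

Lemma frob_le_l1norm m n (A : 'M[K]_(m, n)) : frob_norm S A <= `[A].
Proof.
rewrite frob_normE -[leRHS]ger0_norm ?l1norm_ge0 // -sqrtr_sqr.
rewrite ler_wsqrtr // expr2 /l1norm mulr_suml; apply: ler_sum => i _.
rewrite mulr_suml; apply: ler_sum => j _.
by rewrite expr2 ler_wpM2l ?modulus_ge0 // l1norm_entry.
Qed.

End Norm.

(** * Topology and B-differentiability *)

Section Topology.
Variables (R : realType) (K : numFieldType) (S : real_or_complex R K).
Local Notation "`[ A ]" := (l1norm S A) (at level 0, A at level 99).

Lemma nbhs_l1norm (m n : nat) (z : 'M[K]_(m, n)) (P : set 'M[K]_(m, n)) :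
  nbhs z P <-> exists2 e : R, 0 < e & forall y, `[y - z] < e -> P y.
Proof.
split=> [/nbhs_ballP[_ /= /(gt0_of_real S)[e e0 ->] zP]|[e e0 zP]].
  exists e => // y yz; apply: zP; split=> [|i j]; first by rewrite -(rmorph0 (of_real S)) ltr_of_real.
  rewrite -ball_normE /= distrC -(of_real_modulus S) ltr_of_real.
  by apply: le_lt_trans yz; have := l1norm_entry S (y - z) i j; rewrite !mxE.
(* The successor keeps the radius meaningful when m n = 0 and makes the last inequality strict. *)
have c0 : 0 < (m * n).+1%:R :> R by rewrite ltr0n.
apply/nbhs_ballP; exists (of_real S (e / (m * n).+1%:R)) => /=.
  by rewrite -(rmorph0 (of_real S)) ltr_of_real divr_gt0.
move=> y [_ yz]; apply: zP.
have : `[y - z] <= (m * n)%:R * (e / (m * n).+1%:R).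
  apply: l1norm_le => i j; have := yz i j; rewrite -ball_normE /= distrC.
  by rewrite -(of_real_modulus S) ltr_of_real !mxE; apply: ltW.
move/le_lt_trans; apply; rewrite mulrCA gtr_pMr // ltr_pdivrMr // mul1r.
by rewrite ltr_nat.
Qed.

Lemma cvg_at_right_l1norm (m n : nat) (f : R -> 'M[K]_(m, n)) (l : 'M[K]_(m, n)) :
  f t @[t --> 0^'+] --> l <->
  forall e : R, 0 < e -> exists2 d : R, 0 < d &
    forall t, 0 < t -> t < d -> `[f t - l] < e.
Proof.
split=> [fl e e0|fl P /nbhs_l1norm[e e0 zP]].
  have : nbhs l [set y | `[y - l] < e] by apply/nbhs_l1norm; exists e.
  move=> /fl /nbhs_ballP[d /= d0 dP]; exists d => // t t0 td; apply: dP => //.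
  by rewrite -ball_normE /= sub0r normrN gtr0_norm.
have [d d0 dP] := fl e e0; apply/nbhs_ballP; exists d => // t /=.
rewrite -ball_normE /= sub0r normrN => td t0; apply/zP/dP => //.
by rewrite gtr0_norm in td.
Qed.

Section Directional.
Variables (m n p q : nat) (F : 'M[K]_(m, n) -> 'M[K]_(p, q)) (z : 'M[K]_(m, n)).

(** Multiplying the difference quotient by t leaves a plain norm inequality, so that expansions of
    [F] can be inserted without any division. *)
Definition has_dir_derivative (h : 'M[K]_(m, n)) (T : 'M[K]_(p, q)) : Prop :=
  forall e : R, 0 < e -> exists2 d : R, 0 < d & forall t, 0 < t -> t < d ->
    `[F (z + of_real S t *: h) - F z - of_real S t *: T] <= e * t.

Lemma has_dir_derivative_cvg h T :
  has_dir_derivative h T <-> diff_quotient S F z h t @[t --> 0^'+] --> T.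
Proof.
have quot t (A : 'M[K]_(p, q)) : 0 < t ->
    `[of_real S t^-1 *: A - T] = t^-1 * `[A - of_real S t *: T].
  move=> t0; rewrite -[in LHS](scale1r T) -(rmorph1 (of_real S)).
  rewrite -(mulVf (lt0r_neq0 t0)) rmorphM -scalerA -scalerBr l1normZ.
  by rewrite modulus_of_real gtr0_norm ?invr_gt0.
split=> [FT|/cvg_at_right_l1norm FT].
  apply/cvg_at_right_l1norm => e e0.
  have [d d0 dP] := FT (e / 2) (divr_gt0 e0 (ltr0Sn _ 1)).
  exists d => // t t0 td; rewrite quot // mulrC ltr_pdivrMr //.
  apply: le_lt_trans (dP t t0 td) _; rewrite ltr_pM2r //; lra.
move=> e e0; have [d d0 dP] := FT e e0; exists d => // t t0 td.
have := dP t t0 td; rewrite quot // mulrC ltr_pdivrMr // => /ltW //.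
Qed.

Lemma has_dir_derivative_unique h T1 T2 :
  has_dir_derivative h T1 -> has_dir_derivative h T2 -> T1 = T2.
Proof.
move=> FT1 FT2; apply/eqP; rewrite -subr_eq0; apply/eqP/(@l1norm_eq0 _ _ S).
apply/eqP; rewrite eq_le l1norm_ge0 andbT; apply/ler_addgt0Pr => e e0.
have e2 : 0 < e / 2 by rewrite divr_gt0.
have [d1 d10 P1] := FT1 _ e2; have [d2 d20 P2] := FT2 _ e2.
pose t := Num.min d1 d2 / 2.
have t0 : 0 < t by rewrite divr_gt0 // lt_min d10.
have t12 : t < Num.min d1 d2 by rewrite /t ltr_pdivrMr // ltr_pMr ?ltr1n // lt_min d10.
move: (t12); rewrite lt_min => /andP[td1 td2].
rewrite add0r -(ler_pM2r t0) mulrC -[in leLHS](gtr0_norm t0).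
rewrite -(modulus_of_real S) -l1normZ scalerBr l1normBC.
set A := F (z + of_real S t *: h) - F z.
apply: le_trans (l1norm_triangle _ A _ _) _.
rewrite -[_ - A]opprB l1normN.
by have := lerD (P2 t t0 td2) (P1 t t0 td1); rewrite -mulrDl -splitr.
Qed.

(** Norm equivalence costs a factor (m n)^(1 + rho), and [|C|] replaces a constant of unknown sign.
    On the right a single T serves as derivative and in the remainder, as it comes out of one
    decomposition of h. *)
Lemma B_differentiableP (rho : R) : 0 < rho ->
  B_differentiable S F rho z <->
  exists C r : R, 0 < r /\ forall h, exists2 T, has_dir_derivative h T &
    `[h] < r -> `[F (z + h) - F z - T] <= C * `[h] `^ (1 + rho).
Proof.
move=> rho0; have rho1 : 0 <= 1 + rho by rewrite addr_ge0 // ltW.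
split=> [[Fdir [C /nbhs_l1norm[r r0 FC]]]|[C [r [r0 FC]]]].
  exists ((p * q)%:R * `|C|), r; split=> // h; exists (dir_derivative S F z h).
    exact/has_dir_derivative_cvg/Fdir.
  move=> hr; apply: le_trans (l1norm_le_frob S _) _; rewrite -mulrA ler_wpM2l //.
  apply: le_trans (FC h _) _; rewrite ?subr0 //.
  apply: (@le_trans _ _ (`|C| * frob_norm S h `^ (1 + rho))).
    by rewrite ler_wpM2r ?powR_ge0 ?ler_norm.
  rewrite ler_wpM2l // ge0_ler_powR // ?nnegrE ?frob_norm_ge0 ?l1norm_ge0 //.
  exact: frob_le_l1norm.
split=> [h|]; first by have [T /has_dir_derivative_cvg FT _] := FC h; apply/cvg_ex; exists T.
exists (`|C| * (m * n)%:R `^ (1 + rho)); apply/nbhs_l1norm; exists r => // h.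
rewrite subr0 => hr; have [T FT /(_ hr) FhT] := FC h.
have -> : dir_derivative S F z h = T.
  apply: has_dir_derivative_unique FT; apply/has_dir_derivative_cvg.
  by have [T' /has_dir_derivative_cvg FT' _] := FC h; apply/cvg_ex; exists T'.
apply: le_trans (frob_le_l1norm S _) _; apply: le_trans FhT _.
apply: (@le_trans _ _ (`|C| * `[h] `^ (1 + rho))).
  by rewrite ler_wpM2r ?powR_ge0 ?ler_norm.
rewrite -mulrA ler_wpM2l // -powRM ?frob_norm_ge0 //.
rewrite ge0_ler_powR // ?nnegrE ?mulr_ge0 ?frob_norm_ge0 ?l1norm_ge0 //.
exact: l1norm_le_frob.
Qed.

End Directional.
End Topology.

(** * Common singular pairs *)

Section Hermitian.
Variables (R : realType) (K : numFieldType) (S : real_or_complex R K).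
Local Notation "A ^*h" := (adjoint S A) (at level 8, format "A ^*h").

Definition sqnorm (n : nat) (u : 'rV[K]_n) : R := \sum_j modulus S (u 0 j) ^+ 2.

Lemma mulmx_adjoint_row n (u : 'rV[K]_n) : u *m u^*h = (of_real S (sqnorm u))%:M.
Proof.
apply/matrixP => i j; rewrite !mxE !ord1 eqxx mulr1n rmorph_sum.
by apply: eq_bigr => k _; rewrite adjointE mul_conj.
Qed.

Lemma sqnorm_ge0 n (u : 'rV[K]_n) : 0 <= sqnorm u.
Proof. by apply: sumr_ge0 => j _; rewrite exprn_ge0 ?modulus_ge0. Qed.

Lemma sqnorm_eq0 n (u : 'rV[K]_n) : sqnorm u = 0 -> u = 0.
Proof.
move=> /eqP; rewrite psumr_eq0 => [/allP u0|j _]; last first.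
  by rewrite exprn_ge0 ?modulus_ge0.
apply/rowP => j; rewrite mxE; apply/eqP; rewrite -(modulus0_eq0 S).
by have := u0 j (mem_index_enum j); rewrite expf_eq0.
Qed.

Lemma conj_fixed_real (z : K) : conj_scalar S z = z -> exists a, z = of_real S a.
Proof.
case: S z => [z|[a b]] /=; first by exists z.
move=> -[bN]; exists a; congr Complex; lra.
Qed.

Lemma hermitian_eigenvalue_real n (H : 'M[K]_n) (w : 'rV[K]_n) (l : K) :
  H^*h = H -> w != 0 -> w *m H = l *: w -> exists a, l = of_real S a.
Proof.
move=> HH w0 wH; apply: conj_fixed_real; apply/eqP.
have : (w *m H *m w^*h)^*h = w *m H *m w^*h.
  by rewrite !adjointM adjointK HH mulmxA.
rewrite wH -scalemxAl mulmx_adjoint_row adjointZ.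
move/matrixP/(_ 0 0); rewrite adjoint_scalar !mxE eqxx mulr1n conj_of_real.
move/eqP; rewrite -subr_eq0 -mulrBl mulf_eq0 subr_eq0 => /orP[//|].
rewrite -(rmorph0 (of_real S)) (inj_eq (@of_real_inj _ _ S)) => /eqP/sqnorm_eq0 w00.
by rewrite w00 eqxx in w0.
Qed.

(** The Jordan-Wielandt matrix: an eigenvector (u, v) is a pair of left and right singular vectors.
    The dilations of X and D commute exactly when X D^* = D X^* and X^* D = D^* X. *)
Definition dilation (m n : nat) (X : 'M[K]_(m, n)) : 'M[K]_(m + n) :=
  block_mx 0 X X^*h 0.

Lemma dilation_hermitian m n (X : 'M[K]_(m, n)) : (dilation X)^*h = dilation X.
Proof.
rewrite /dilation {1}/adjoint map_block_mx tr_block_mx.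
rewrite !map_mx0 !trmx0; congr block_mx.
exact: adjointK.
Qed.

End Hermitian.

(** The row space of M is stable under both matrices, so a common eigenvector can be sought inside
    it. For Hermitian M this forces a nonzero eigenvalue, since M is injective on its own image. *)
Lemma common_eigenvector_image (C : numClosedFieldType) (n : nat) (M N : 'M[C]_n) :
  M *m N = N *m M -> M != 0 -> exists (w : 'rV[C]_n) (a b : C),
  [/\ w != 0, (w <= M)%MS, w *m M = a *: w & w *m N = b *: w].
Proof.
move=> MN M0.
have sMM : stablemx M M by rewrite submxMl.
have sMN : stablemx M N by rewrite MN submxMl.
have rM : (0 < \rank M)%N by rewrite lt0n mxrank_eq0.
have cMN : restrictmx M M *m restrictmx M N = restrictmx M N *m restrictmx M M.
  by rewrite -!conjmxM ?inE ?stablemx_row_base // MN.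
have [v v0 /andP[vM vN]] := common_eigenvector2 rM cMN.
pose w := v *m row_base M.
have /eigenvectorP[a /eigenspaceP wM] : stablemx w M by rewrite -stablemx_restrict.
have /eigenvectorP[b /eigenspaceP wN] : stablemx w N by rewrite -stablemx_restrict.
exists w, a, b; split=> //; first by rewrite mulmx_free_eq0 ?row_base_free.
by rewrite (submx_trans (submxMl _ _)) ?eq_row_base.
Qed.

Lemma common_row_pair_complex (R : realType) (m n : nat) (X D : 'M[R[i]]_(m, n)) :
  X *m adjoint ComplexField D = D *m adjoint ComplexField X ->
  adjoint ComplexField X *m D = adjoint ComplexField D *m X ->
  X != 0 -> exists (u : 'rV_m) (v : 'rV_n) (a b : R),
  [/\ row_mx u v != 0, a != 0 &
   [/\ v *m adjoint ComplexField X = a%:C%C *: u, u *m X = a%:C%C *: v,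
     v *m adjoint ComplexField D = b%:C%C *: u & u *m D = b%:C%C *: v]].
Proof.
set S := ComplexField; move=> XD DX X0.
pose M := dilation S X; pose N := dilation S D.
have MN : M *m N = N *m M.
  by rewrite /M /N /dilation !mulmx_block !mul0mx !mulmx0 !addr0 !add0r XD DX.
have M0 : M != 0.
  apply: contra X0 => /eqP; rewrite /M /dilation -block_mx0 => /eq_block_mx[_ -> _ _].
  by rewrite eqxx.
have [w [a [b [w0 wsM wM wN]]]] := common_eigenvector_image MN M0.
have [a' a'E] := hermitian_eigenvalue_real (dilation_hermitian S X) w0 wM.
have [b' b'E] := hermitian_eigenvalue_real (dilation_hermitian S D) w0 wN.
exists (lsubmx w), (rsubmx w), a', b'; rewrite hsubmxK.
(* Since w = y M for some y and M is Hermitian, w M = 0 would give w w^* = y M w^* = 0. *)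
have a'0 : a' != 0.
  apply/eqP => a0; move: w0; apply/negP/negPn/eqP/(@sqnorm_eq0 _ _ S).
  have /submxP[y wy] := wsM.
  have : w *m adjoint S w = 0.
    have -> : w *m adjoint S w = y *m adjoint S (w *m M).
      by rewrite adjointM dilation_hermitian mulmxA -wy.
    by rewrite wM a'E a0 rmorph0 scale0r raddf0 mulmx0.
  rewrite mulmx_adjoint_row => /matrixP/(_ 0 0); rewrite !mxE eqxx mulr1n.
  by move/eqP; rewrite -(rmorph0 (of_real S)) (inj_eq (@of_real_inj _ _ S)) => /eqP.
split=> //; move: (lsubmx w) (rsubmx w) (hsubmxK w) => u v wE.
move: wM wN; rewrite -wE /M /N /dilation !mul_row_block.
rewrite !mulmx0 !addr0 !add0r a'E b'E !scale_row_mx.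
by move=> /eq_row_mx[-> ->] /eq_row_mx[-> ->].
Qed.

(** The eigenvalues a and b found over the complex numbers are real and X, D are real matrices, so
    the real part of a complex pair again satisfies the four equations. *)
Lemma common_row_pair_real (R : realType) (m n : nat) (X D : 'M[R]_(m, n)) :
  X *m adjoint RealField D = D *m adjoint RealField X ->
  adjoint RealField X *m D = adjoint RealField D *m X ->
  X != 0 -> exists (u : 'rV_m) (v : 'rV_n) (a b : R),
  [/\ row_mx u v != 0, a != 0 &
   [/\ v *m adjoint RealField X = a *: u, u *m X = a *: v,
     v *m adjoint RealField D = b *: u & u *m D = b *: v]].
Proof.
pose toC := @map_mx _ _ (real_complex R).
have adjC p q (A : 'M[R]_(p, q)) :
    adjoint ComplexField (toC p q A) = toC q p (adjoint RealField A).
  by apply/matrixP => i j; rewrite !mxE /= oppr0.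
have ReM p q r (A : 'M[R[i]]_(p, q)) (B : 'M[R]_(q, r)) :
    map_mx (@complex.Re R) (A *m toC q r B) = map_mx (@complex.Re R) A *m B.
  apply/matrixP => i j; rewrite !mxE (raddf_sum (re_part (@ComplexField R))).
  apply: eq_bigr => k _; rewrite !mxE mulrC.
  transitivity (B k j * complex.Re (A i k)); last exact: mulrC.
  exact: (re_part_mul_of_real (@ComplexField R)).
have ReZ p q (a : R) (A : 'M[R[i]]_(p, q)) :
    map_mx (@complex.Re R) (a%:C%C *: A) = a *: map_mx (@complex.Re R) A.
  by apply/matrixP => i j; rewrite !mxE; exact: (re_part_mul_of_real (@ComplexField R)).
move=> XD DX X0.
have [|||u [v [a [b [w0 a0 [vX uX vD uD]]]]]] :=
    @common_row_pair_complex R m n (toC m n X) (toC m n D).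
- by rewrite !adjC -!map_mxM XD.
- by rewrite !adjC -!map_mxM DX.
- by rewrite map_mx_eq0.
(* The real part of the pair itself may vanish. Multiplying by the conjugate of a nonzero entry
   turns that entry into a positive real number. *)
have [c c0] : exists c : R[i], map_mx (@complex.Re R) (c *: row_mx u v) != 0.
  have /existsNP[i /eqP wi] : ~ (forall i, row_mx u v 0 i = 0).
    by move=> w00; move: w0 => /eqP; apply; apply/rowP => i; rewrite w00 mxE.
  exists (conjc (row_mx u v 0 i)); apply/eqP => /rowP/(_ i)/esym.
  rewrite mxE [RHS]mxE [X in complex.Re X]mxE mulrC.
  rewrite [X in complex.Re X](mul_conj (@ComplexField R)) => /esym/eqP.
  by rewrite expf_eq0 modulus0_eq0 (negPf wi).
exists (map_mx (@complex.Re R) (c *: u)), (map_mx (@complex.Re R) (c *: v)), a, b.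
rewrite -map_row_mx -scale_row_mx; split=> //.
by split; rewrite -!ReM -!scalemxAl -?adjC ?(vX, uX, vD, uD) -ReZ !scalerA mulrC.
Qed.

Section SingularPair.
Variables (R : realType) (K : numFieldType) (S : real_or_complex R K).
Local Notation "A ^*h" := (adjoint S A) (at level 8, format "A ^*h").

Lemma common_row_pair (m n : nat) (X D : 'M[K]_(m, n)) :
  X *m D^*h = D *m X^*h -> X^*h *m D = D^*h *m X ->
  X != 0 -> exists (u : 'rV_m) (v : 'rV_n) (a b : R),
  [/\ row_mx u v != 0, a != 0 &
   [/\ v *m X^*h = of_real S a *: u, u *m X = of_real S a *: v,
     v *m D^*h = of_real S b *: u & u *m D = of_real S b *: v]].
Proof.
by case: S X D => X D; [exact: common_row_pair_real | exact: common_row_pair_complex].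
Qed.

Definition singular_pair m n (X : 'M[K]_(m, n)) (u : 'cV_m) (v : 'cV_n) (a : R) :=
  X *m v = of_real S a *: u /\ X^*h *m u = of_real S a *: v.

(** Evaluating v X^* u^* in two ways gives a |u|^2 = a |v|^2. As a is nonzero, u and v have equal
    norms and one factor c normalizes both; adjoints then turn rows into columns. *)
Lemma common_singular_pair_neq0 (m n : nat) (X D : 'M[K]_(m, n)) :
  X *m D^*h = D *m X^*h -> X^*h *m D = D^*h *m X ->
  X != 0 -> exists (u : 'cV_m) (v : 'cV_n) (a b : R),
  [/\ u^*h *m u = 1%:M, v^*h *m v = 1%:M, singular_pair X u v a & singular_pair D u v b].
Proof.
move=> XD DX X0.
have [u [v [a [b [w0 a0 [vX uX vD uD]]]]]] := common_row_pair XD DX X0.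
have uv : sqnorm S u = sqnorm S v.
  have : v *m X^*h *m u^*h = v *m (u *m X)^*h by rewrite adjointM mulmxA.
  rewrite vX uX adjointZ conj_of_real -scalemxAl -scalemxAr !mulmx_adjoint_row.
  move=> /(scalerI _)/matrixP/(_ 0 0); rewrite !mxE eqxx !mulr1n.
  move=> /(_ _) /of_real_inj; apply.
  by rewrite -(rmorph0 (of_real S)) (inj_eq (@of_real_inj _ _ S)).
pose c := (Num.sqrt (sqnorm S u))^-1.
have cc : c * c * sqnorm S u = 1.
  have u0 : sqnorm S u != 0.
    apply: contra w0 => /eqP u0; rewrite (sqnorm_eq0 u0) .
    by rewrite uv in u0; rewrite (sqnorm_eq0 u0) row_mx0.
  by rewrite -invfM -expr2 sqr_sqrtr ?sqnorm_ge0 // mulVf.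
exists (of_real S c *: u^*h), (of_real S c *: v^*h), a, b.
have uniti k (x : 'rV[K]_k) : sqnorm S x = sqnorm S u ->
    (of_real S c *: x^*h)^*h *m (of_real S c *: x^*h) = 1%:M.
  move=> xu; rewrite adjointZ adjointK conj_of_real -scalemxAl -scalemxAr.
  by rewrite scalerA mulmx_adjoint_row xu scale_scalar_mx -!rmorphM cc rmorph1.
have eX A k : v *m A^*h = of_real S k *: u ->
    A *m (of_real S c *: v^*h) = of_real S k *: (of_real S c *: u^*h).
  move=> /(congr1 (@adjoint _ _ S _ _)).
  rewrite adjointM adjointK adjointZ conj_of_real -scalemxAr => ->.
  by rewrite !scalerA mulrC.
have eX' A k : u *m A = of_real S k *: v ->
    A^*h *m (of_real S c *: u^*h) = of_real S k *: (of_real S c *: v^*h).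
  move=> /(congr1 (@adjoint _ _ S _ _)).
  rewrite adjointM adjointZ conj_of_real -scalemxAr => ->.
  by rewrite !scalerA mulrC.
by split; rewrite ?uniti //; split; [exact: eX|exact: eX'|exact: eX|exact: eX'].
Qed.

End SingularPair.

(** * Simultaneous singular value decomposition *)

Section SimultaneousSVD.
Variables (R : realType) (K : numFieldType) (S : real_or_complex R K).
Local Notation "A ^*h" := (adjoint S A) (at level 8, format "A ^*h").

Lemma adjoint_delta_unit n (i : 'I_n) :
  (delta_mx i 0 : 'cV[K]_n)^*h *m delta_mx i (0 : 'I_1) = 1%:M.
Proof.
rewrite /adjoint map_delta_mx rmorph1 trmx_delta mul_delta_mx.
by apply/matrixP => j k; rewrite !mxE !ord1 !eqxx.
Qed.

(** When X = 0 the roles of X and D are exchanged, and when both vanish the first basis vectors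
    serve, with values 0. *)
Lemma common_singular_pair (m n : nat) (X D : 'M[K]_(m.+1, n.+1)) :
  X *m D^*h = D *m X^*h -> X^*h *m D = D^*h *m X ->
  exists (u : 'cV_m.+1) (v : 'cV_n.+1) (a b : R),
  [/\ u^*h *m u = 1%:M, v^*h *m v = 1%:M,
      singular_pair S X u v a & singular_pair S D u v b].
Proof.
move=> XD DX; have [X0|X0] := eqVneq X 0; last exact: common_singular_pair_neq0.
have [D0|D0] := eqVneq D 0; last first.
  have [u [v [a [b [? ? ? ?]]]]] := common_singular_pair_neq0 (esym XD) (esym DX) D0.
  by exists u, v, b, a.
exists (delta_mx 0 0), (delta_mx 0 0), 0, 0; rewrite X0 D0.
split; rewrite ?adjoint_delta_unit //;
  by split; rewrite !raddf0 !mul0mx scale0r.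
Qed.

(* Householder reflection exchanging the first basis vector and [b *: u], where
   the unimodular [b] makes the first entry of [b *: u] a nonnegative real. *)
Lemma unitary_completion n (u : 'cV[K]_n.+1) : u^*h *m u = 1%:M ->
  exists2 U : 'M[K]_n.+1, unitary S U & U *m delta_mx 0 0 = u.
Proof.
move=> u1; pose x := u 0 0.
pose b := if x == 0 then 1 else conj_scalar S x / of_real S (modulus S x).
have bx : b * x = of_real S (modulus S x).
  rewrite /b; have [->|x0] := eqVneq x 0; first by rewrite mulr0 modulus0 raddf0.
  rewrite mulrAC [_ * x]mulrC mul_conj expr2 rmorphM mulfK //.
  by rewrite -(rmorph0 (of_real S)) (inj_eq (@of_real_inj _ _ S)) modulus0_eq0.
have bb : conj_scalar S b * b = 1.
  rewrite /b; have [_|x0] := eqVneq x 0; first by rewrite rmorph1 mulr1.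
  rewrite mulrC mul_conj modulusM modulus_conj modulusV modulus_of_real.
  by rewrite ger0_norm ?modulus_ge0 // divff ?expr1n ?rmorph1 ?modulus0_eq0.
pose e : 'cV[K]_n.+1 := delta_mx 0 0; pose r := of_real S (modulus S x).
pose w := e - b *: u.
have ee : e^*h *m e = 1%:M by exact: adjoint_delta_unit.
have eu : e^*h *m (b *: u) = r%:M.
  apply/matrixP => i j; rewrite /e /adjoint map_delta_mx ?rmorph1 trmx_delta -rowE.
  by rewrite !mxE !ord1 bx eqxx mulr1n.
have ue : (b *: u)^*h *m e = r%:M.
  by rewrite -[LHS](adjointK S) adjointM adjointK eu adjoint_scalar conj_of_real.
have uu : (b *: u)^*h *m (b *: u) = 1%:M.
  by rewrite adjointZ -scalemxAl -scalemxAr scalerA bb scale1r.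
pose q := 2 - 2 * r.
have ww : w^*h *m w = q%:M.
  rewrite /w (raddfB (@adjoint _ _ S _ _)) /= mulmxBl !mulmxBr ee eu ue uu.
  by rewrite -!raddfB /=; congr (_%:M); rewrite /q; ring.
have we : w^*h *m e = (1 - r)%:M by rewrite /w (raddfB (@adjoint _ _ S _ _)) /= mulmxBl ee ue raddfB.
pose H := 1%:M - (2 / q) *: (w *m w^*h).
have qr : conj_scalar S q = q by rewrite /q /r rmorphB rmorphM /= conj_of_real rmorph_nat.
have HH : H^*h = H.
  rewrite /H raddfB /= adjoint1 adjointZ adjointM adjointK.
  by rewrite fmorph_div /= rmorph_nat qr.
have H2 : H *m H = 1%:M.
  have wwww : (w *m w^*h) *m (w *m w^*h) = q *: (w *m w^*h).
    by rewrite mulmxA -(mulmxA w) ww mul_mx_scalar -scalemxAl.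
  have cq : 2 / q * (2 / q) * q = 2 / q + 2 / q.
    have [->|q0] := eqVneq q 0; first by rewrite invr0 !mulr0 addr0.
    by field.
  rewrite /H mulmxBl !mulmxBr !mul1mx mulmx1 -scalemxAl -scalemxAr wwww.
  by rewrite !scalerA cq scalerDl opprB addrK subrK.
have He : H *m e = b *: u.
  rewrite /H mulmxBl mul1mx -scalemxAl -mulmxA we mul_mx_scalar scalerA.
  (* Here q is the squared norm of w. If q = 0 then [2 / q] is 0, so H is the identity, and w = 0
     means that e already equals b *: u. *)
  have [q0|q0] := eqVneq q 0.
    suff w0 : w = 0 by rewrite w0 scaler0 subr0 -[LHS](subrK (b *: u)) -/w w0 add0r.
    have : sqnorm S w^*h = 0.
      have := mulmx_adjoint_row S w^*h; rewrite adjointK ww q0.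
      move=> /matrixP/(_ 0 0); rewrite !mxE eqxx !mulr1n => /esym/eqP.
      by rewrite -(rmorph0 (of_real S)) (inj_eq (@of_real_inj _ _ S)) => /eqP.
    by move=> /sqnorm_eq0/(congr1 (@adjoint _ _ S _ _)); rewrite adjointK raddf0.
  have -> : 2 / q * (1 - r) = 1 by rewrite /q in q0 *; field.
  by rewrite scale1r opprB addrC subrK.
exists (conj_scalar S b *: H).
  rewrite /unitary adjointZ HH conj_scalarK -scalemxAl -scalemxAr scalerA H2.
  by rewrite bb scale1r.
by rewrite -scalemxAl He scalerA bb scale1r.
Qed.

Lemma diag_blockE m n (x : 'cV[R]_m) (i : 'I_m) (j : 'I_n) :
  diag_block S n x i j = if i == j :> nat then of_real S (x i 0) else 0.
Proof. by rewrite mxE; case: (i == j :> nat). Qed.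

Lemma diag_block_col_mx m n (a : R) (x : 'cV[R]_m) :
  diag_block S (1 + n) (col_mx a%:M x) =
  block_mx (of_real S a)%:M 0 0 (diag_block S n x) :> 'M[K]_(1 + m, 1 + n).
Proof.
apply/matrixP => i j; rewrite -(fintype.splitK i) -(fintype.splitK j).
case: (fintype.split i) => {}i; case: (fintype.split j) => {}j /=.
- by rewrite block_mxEul diag_blockE col_mxEu !mxE !ord1 eqxx !mulr1n.
- by rewrite block_mxEur diag_blockE [RHS]mxE (ord1 i).
- by rewrite block_mxEdl diag_blockE [RHS]mxE (ord1 j).
- by rewrite block_mxEdr !diag_blockE col_mxEd.
Qed.

Lemma adjoint_block_mx m1 m2 n1 n2 (A : 'M[K]_(m1, n1)) (B : 'M[K]_(m1, n2))
    (C : 'M[K]_(m2, n1)) (E : 'M[K]_(m2, n2)) :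
  (block_mx A B C E)^*h = block_mx A^*h C^*h B^*h E^*h.
Proof. by rewrite /adjoint map_block_mx tr_block_mx. Qed.

(** The equation for X v clears the first column of U^* X V below the corner, the one for X^* u
    clears its first row. *)
Lemma singular_pair_deflate m n (X : 'M[K]_(1 + m, 1 + n)) u v a
    (U : 'M[K]_(1 + m)) (V : 'M[K]_(1 + n)) :
  unitary S U -> unitary S V -> U *m delta_mx 0 0 = u -> V *m delta_mx 0 0 = v ->
  singular_pair S X u v a ->
  U^*h *m X *m V = block_mx (of_real S a)%:M 0 0 (drsubmx (U^*h *m X *m V)).
Proof.
move=> UU VV Ue Ve [Xv Xu]; set Y := U^*h *m X *m V.
have Ye : Y *m delta_mx 0 0 = of_real S a *: delta_mx 0 (0 : 'I_1).
  by rewrite /Y -mulmxA Ve -mulmxA Xv -scalemxAr -Ue mulmxA unitaryC // mul1mx.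
have Ye' : Y^*h *m delta_mx 0 0 = of_real S a *: delta_mx 0 (0 : 'I_1).
  rewrite /Y !adjointM adjointK -!mulmxA Ue Xu -scalemxAr -Ve mulmxA.
  by rewrite unitaryC // mul1mx.
have Yi0 i : Y i 0 = of_real S a *+ (i == 0).
  have := congr1 (fun A : 'cV_ _ => A i 0) Ye; rewrite -colE !mxE /= andbT => ->.
  by rewrite mulr_natr.
have Y0j j : Y 0 j = of_real S a *+ (j == 0).
  have := congr1 (fun A : 'cV_ _ => A j 0) Ye'; rewrite -colE mxE adjointE.
  move=> /(congr1 (conj_scalar S)); rewrite conj_scalarK => ->.
  by rewrite !mxE /= andbT mulr_natr raddfMn /= conj_of_real.
have l0 k : lshift k (0 : 'I_1) = 0 :> 'I_(1 + k) by apply: val_inj.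
clearbody Y; rewrite -[LHS]submxK; congr block_mx; apply/matrixP => i j; rewrite !mxE !ord1.
- by rewrite l0 ?l0 Yi0 eqxx.
- by rewrite l0 ?l0 Y0j.
- by rewrite l0 ?l0 Yi0.
Qed.

(** Deflation by a common singular pair, then induction: both commutation relations survive unitary
    changes of frame and pass to the lower right blocks. The diagonals x and d are real, with no
    control on sign or order yet. *)
Lemma simultaneous_svd_weak (m n : nat) (X D : 'M[K]_(m, n)) : (m <= n)%N ->
  X *m D^*h = D *m X^*h -> X^*h *m D = D^*h *m X ->
  exists (W : 'M[K]_m) (Z : 'M[K]_n) (x d : 'cV[R]_m),
  [/\ unitary S W, unitary S Z, X = W *m diag_block S n x *m Z^*h
    & D = W *m diag_block S n d *m Z^*h].
Proof.
elim: m n X D => [|m IH] n X D le_mn XD DX.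
  exists 1%:M, 1%:M, 0, 0; split; [exact: unitary1|exact: unitary1| |];
    by rewrite [LHS]flatmx0 [RHS]flatmx0.
case: n X D le_mn XD DX => [//|n] X D le_mn XD DX.
move: X D XD DX; rewrite -[m.+1]/(1 + m)%N -[n.+1]/(1 + n)%N => X D XD DX.
have [u [v [a [b [u1 v1 Xuv Duv]]]]] : exists (u : 'cV_(1 + m)) (v : 'cV_(1 + n))
    (a b : R), [/\ u^*h *m u = 1%:M, v^*h *m v = 1%:M,
      singular_pair S X u v a & singular_pair S D u v b].
  exact: common_singular_pair.
have completion k (x : 'cV_(1 + k)) : x^*h *m x = 1%:M ->
    exists2 U : 'M[K]_(1 + k), unitary S U & U *m delta_mx 0 0 = x.
  exact: unitary_completion.
have [U UU Ue] := completion _ _ u1; have [V VV Ve] := completion _ _ v1.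
have := singular_pair_deflate UU VV Ue Ve Xuv.
have := singular_pair_deflate UU VV Ue Ve Duv.
set X' := drsubmx (_ *m X *m _); set D' := drsubmx (_ *m D *m _) => DE XE.
have [|||W [Z [x [d [WW ZZ X'E D'E]]]]] := IH n X' D' => //.
- have : (U^*h *m X *m V) *m (U^*h *m D *m V)^*h = (U^*h *m D *m V) *m (U^*h *m X *m V)^*h.
    have VVE A B : (U^*h *m A *m V) *m (U^*h *m B *m V)^*h = U^*h *m (A *m B^*h) *m U.
      by rewrite !adjointM adjointK !mulmxA -(mulmxA _ V) VV mulmx1.
    by rewrite !VVE XD.
  rewrite XE DE !adjoint_block_mx !mulmx_block !raddf0 ?mulmx0 ?mul0mx ?addr0 ?add0r.
  by move=> /eq_block_mx[].
- have : (U^*h *m X *m V)^*h *m (U^*h *m D *m V) = (U^*h *m D *m V)^*h *m (U^*h *m X *m V).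
    have UUE A B : (U^*h *m A *m V)^*h *m (U^*h *m B *m V) = V^*h *m (A^*h *m B) *m V.
      by rewrite !adjointM adjointK !mulmxA -(mulmxA _ U) UU mulmx1.
    by rewrite !UUE DX.
  rewrite XE DE !adjoint_block_mx !mulmx_block !raddf0 ?mulmx0 ?mul0mx ?addr0 ?add0r.
  by move=> /eq_block_mx[].
have U1 k (P : 'M[K]_k) : unitary S P -> unitary S (block_mx (1%:M : 'M[K]_1) 0 0 P).
  move=> PP; rewrite /unitary adjoint_block_mx mulmx_block !raddf0 ?mulmx0 ?mul0mx.
  by rewrite ?addr0 ?add0r adjoint1 mulmx1 PP -scalar_mx_block.
have glue (Y : 'M[K]_(1 + m, 1 + n)) c y Y' :
    U^*h *m Y *m V = block_mx (of_real S c)%:M 0 0 Y' ->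
    Y' = W *m diag_block S n y *m Z^*h ->
    Y = U *m block_mx 1%:M 0 0 W *m diag_block S (1 + n) (col_mx c%:M y)
          *m (V *m block_mx 1%:M 0 0 Z)^*h.
  move=> YE Y'E; rewrite adjointM diag_block_col_mx adjoint_block_mx !raddf0.
  rewrite -[LHS](unitary_mulK Y UU (unitary_adjoint VV)) adjointK YE Y'E.
  rewrite !mulmxA; congr (_ *m _); rewrite -!mulmxA; congr (_ *m _).
  rewrite !mulmx_block ?mulmx0 ?mul0mx ?addr0 ?add0r adjoint1 mulmx1 mul1mx.
  by rewrite !mulmx0.
exists (U *m block_mx 1%:M 0 0 W), (V *m block_mx 1%:M 0 0 Z).
exists (col_mx a%:M x), (col_mx b%:M d); split.
- by apply: unitaryM => //; exact: U1.
- by apply: unitaryM => //; exact: U1.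
- exact: glue XE X'E.
- exact: glue DE D'E.
Qed.

End SimultaneousSVD.

(** * Signed permutations and singular values *)

Section SignedPermutations.
Variables (R : realType) (m : nat).
Implicit Types (p : 'S_m) (b : 'I_m -> bool) (x y : 'cV[R]_m).

Definition signed_perm p b x : 'cV[R]_m := \col_i ((-1) ^+ b i * x (p i) 0).

Definition signed_perm_matrix p b : 'M[R]_m :=
  \matrix_(i, j) if j == p i then (-1) ^+ b i else 0.

Lemma signed_perm_matrixP p b : signed_perm_mx (signed_perm_matrix p b).
Proof.
have nz i j : (signed_perm_matrix p b i j != 0) = (j == p i).
  rewrite mxE; have [_|_] := eqVneq j (p i); last by rewrite eqxx.
  by rewrite signr_eq0.
split=> [i j|i|j].
- rewrite mxE; have [_|_] := eqVneq j (p i); last by rewrite !inE eqxx.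
  by case: (b i); rewrite !inE ?expr1 ?expr0 eqxx ?orbT.
- exists (p i); split=> [|j]; first by rewrite nz.
  by rewrite nz => /eqP.
- exists (p^-1 j)%g; split=> [|i]; first by rewrite nz permKV.
  by rewrite nz => /eqP ->; rewrite permK.
Qed.

Lemma mul_signed_perm_matrix p b x : signed_perm_matrix p b *m x = signed_perm p b x.
Proof.
apply/matrixP => i j; rewrite !mxE (bigD1 (p i)) //= big1 => [|k kpi].
  by rewrite addr0 mxE eqxx ord1.
by rewrite mxE (negPf kpi) mul0r.
Qed.

Lemma signed_perm_inv p b y : exists x, y = signed_perm p b x.
Proof.
exists (\col_i ((-1) ^+ b (p^-1 i)%g * y (p^-1 i)%g 0)).
by apply/colP => i; rewrite !mxE permK signrMK.
Qed.

Lemma signed_permB p b x y :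
  signed_perm p b (x - y) = signed_perm p b x - signed_perm p b y.
Proof. by apply/colP => i; rewrite !mxE mulrBr. Qed.

Lemma abs_sym_signed_perm (D : set 'cV[R]_m) (g : 'cV[R]_m -> 'cV[R]_m) p b x :
  absolutely_symmetric D g -> D x ->
  g (signed_perm p b x) = signed_perm p b (g x).
Proof.
by move=> gD Dx; rewrite -!mul_signed_perm_matrix gD //; exact: signed_perm_matrixP.
Qed.

Lemma perm_sqr_signed_perm p x y :
  (forall i, y i 0 ^+ 2 = x (p i) 0 ^+ 2) -> exists b, y = signed_perm p b x.
Proof.
move=> yx; exists (fun i => y i 0 != x (p i) 0); apply/colP => i; rewrite mxE.
have [<-|yxi] := eqVneq (y i 0) (x (p i) 0); first by rewrite mul1r.
rewrite expr1 mulN1r; apply/eqP; move/eqP: (yx i).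
by rewrite eqf_sqr (negPf yxi).
Qed.

Lemma signed_perm_sorted x : exists p b, let s := signed_perm p b x in
  (forall i, 0 <= s i 0) /\ (forall i j : 'I_m, (i <= j)%N -> s j 0 <= s i 0).
Proof.
pose t := [tuple `|x i 0| | i < m]; pose s := sort_tuple (fun u v : R => v <= u) t.
have /tuple_permP[p sp] : perm_eq s t by rewrite perm_sort.
have sE i : tnth s i = `|x (p i) 0|.
  have -> : s = [tuple tnth t (p i0) | i0 < m] by apply/val_inj.
  by rewrite !tnth_mktuple.
exists p, (fun i => x (p i) 0 < 0).
have s'E i : signed_perm p (fun i => x (p i) 0 < 0) x i 0 = tnth s i.
  by rewrite mxE sE -normrEsign.
split=> [i|i j ij]; rewrite !s'E; first by rewrite sE.
rewrite !(tnth_nth 0).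
have rs : sorted (fun u v : R => v <= u) s.
  by apply: sort_sorted => u v; exact: le_total.
apply: (sorted_leq_nth _ _ 0 rs) => //.
- by move=> u v w /= uv vw; exact: le_trans vw uv.
- by rewrite inE size_tuple.
- by rewrite inE size_tuple.
Qed.

End SignedPermutations.

(** * Existence of singular values, and their uniqueness up to signed permutation *)

Section SingularValues.
Variables (R : realType) (K : numFieldType) (S : real_or_complex R K).
Local Notation "A ^*h" := (adjoint S A) (at level 8, format "A ^*h").

Lemma perm_mx_unitary n (s : 'S_n) : unitary S (perm_mx s).
Proof.
rewrite /unitary /adjoint map_perm_mx tr_perm_mx -perm_mxM.
by rewrite mulgV perm_mx1.
Qed.

(** The permutation is extended by the identity on the indices from m on. *)
Lemma widen_perm m n (le_mn : (m <= n)%N) (p : 'S_m) :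
  exists q : 'S_n, forall i, q (widen_ord le_mn i) = widen_ord le_mn (p i).
Proof.
pose f (j : 'I_n) := if insub (val j) is Some i then widen_ord le_mn (p i) else j.
have fw i : f (widen_ord le_mn i) = widen_ord le_mn (p i).
  by rewrite /f /= valK.
have f_inj : injective f.
  move=> j1 j2; rewrite /f.
  case: insubP => [i1 _ i1E|j1m]; case: insubP => [i2 _ i2E|j2m].
  - move/(congr1 val) => /= /val_inj/perm_inj i12; apply/val_inj.
    by rewrite -i1E -i2E i12.
  - by move=> E; rewrite -E /= ltn_ord in j2m.
  - by move=> E; rewrite E /= ltn_ord in j1m.
  - by [].
by exists (perm f_inj) => i; rewrite permE.
Qed.

(** The left factor carries the signs, since each row has at most one nonzero entry. P and Q do not
    depend on x: the same pair serves for two diagonals at once, or for a vector and its image under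
    g. *)
Lemma diag_block_signed_perm m n (p : 'S_m) b : (m <= n)%N ->
  exists (P : 'M[K]_m) (Q : 'M[K]_n), [/\ unitary S P, unitary S Q &
    forall x : 'cV[R]_m,
      diag_block S n (signed_perm p b x) = P *m diag_block S n x *m Q^*h].
Proof.
move=> le_mn; have [q qE] := widen_perm le_mn p.
pose s : 'rV[K]_m := \row_i of_real S ((-1) ^+ b i).
have ss : unitary S (diag_mx s).
  rewrite /unitary /adjoint map_diag_mx tr_diag_mx mulmx_diag -diag_const_mx.
  congr diag_mx; apply/rowP => i; rewrite !mxE /= conj_of_real -rmorphM /=.
  by rewrite -expr2 sqrr_sign rmorph1.
exists (diag_mx s *m perm_mx p), (perm_mx q); split.
- by apply: unitaryM => //; exact: perm_mx_unitary.
- exact: perm_mx_unitary.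
move=> x; rewrite /adjoint map_perm_mx tr_perm_mx -!mulmxA -col_permE -row_permE.
apply/matrixP => i j; rewrite mul_diag_mx diag_blockE !mxE.
rewrite -[p i in LHS]/(p i).
have -> : (p i == q j :> nat) = (i == j :> nat).
  have := inj_eq (@perm_inj _ q) (widen_ord le_mn i) j.
  by rewrite qE -!val_eqE.
by case: eqP => _; rewrite /= ?mulr1n ?mulr0n ?mulr0 // rmorphM.
Qed.

Lemma char_poly_unitary_conj m (W A : 'M[K]_m) : unitary S W ->
  char_poly (W *m A *m W^*h) = char_poly A.
Proof.
move=> WW; rewrite /char_poly.
have -> : char_poly_mx (W *m A *m W^*h) =
    map_mx polyC W *m char_poly_mx A *m map_mx polyC W^*h.
  have W'W : map_mx polyC W *m map_mx polyC W^*h = 1%:M by rewrite -map_mxM WW map_mx1.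
  by rewrite /char_poly_mx mulmxBr mulmxBl scalar_mxC -(mulmxA 'X%:M) W'W mulmx1 !map_mxM.
rewrite !det_mulmx mulrAC -det_mulmx -map_mxM WW map_mx1 det1 mul1r //.
Qed.

Lemma char_poly_diag_block m n (W : 'M[K]_m) (Z : 'M[K]_n) (x : 'cV[R]_m) X :
  (m <= n)%N -> unitary S W -> unitary S Z -> X = W *m diag_block S n x *m Z^*h ->
  char_poly (X *m X^*h) = \prod_(i < m) ('X - (of_real S (x i 0) ^+ 2)%:P).
Proof.
move=> le_mn WW ZZ ->.
have -> : W *m diag_block S n x *m Z^*h *m (W *m diag_block S n x *m Z^*h)^*h =
    W *m diag_mx (\row_i of_real S (x i 0) ^+ 2) *m W^*h.
  rewrite !adjointM adjointK !mulmxA -(mulmxA _ Z^*h) unitaryC // mulmx1.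
  congr (_ *m _); rewrite -mulmxA; congr (_ *m _); apply/matrixP => i j.
  rewrite !mxE (bigD1 (widen_ord le_mn i)) //= big1 => [|k ki]; last first.
    rewrite diag_blockE; case: eqP => [ik|]; last by rewrite mul0r.
    by rewrite -val_eqE /= -ik eqxx in ki.
  rewrite addr0 adjointE !diag_blockE /= eqxx; have [->|ij] := eqVneq i j.
    by rewrite eqxx conj_of_real expr2 mulr1n.
  have /negPf -> : j != i :> nat by rewrite val_eqE eq_sym.
  by rewrite raddf0 mulr0.
rewrite char_poly_unitary_conj // char_poly_trig; last exact: diag_mx_is_trig.
by apply: eq_bigr => i _; rewrite !mxE eqxx mulr1n.
Qed.

(** The characteristic polynomial of X X^* splits with roots x_i^2 and also with roots s_i^2. Unique
    factorization matches the squares by a permutation, and square roots leave only signs. *)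
Lemma is_singular_values_diag_block m n (W : 'M[K]_m) (Z : 'M[K]_n) (x s : 'cV[R]_m) X :
  (m <= n)%N -> unitary S W -> unitary S Z -> X = W *m diag_block S n x *m Z^*h ->
  is_singular_values S X s -> exists p b, x = signed_perm p b s.
Proof.
move=> le_mn WW ZZ XE [_ _]; rewrite (char_poly_diag_block le_mn WW ZZ XE).
pose sq (y : 'cV[R]_m) := [tuple of_real S (y i 0) ^+ 2 | i < m].
have sqE (y : 'cV[R]_m) : \prod_(i < m) ('X - (of_real S (y i 0) ^+ 2)%:P) =
    \prod_(a <- sq y) ('X - a%:P).
  by rewrite big_tuple; apply: eq_bigr => i _; rewrite tnth_mktuple.
rewrite !sqE => /prod_XsubC_eq/tuple_permP[p xs]; exists p.
apply: perm_sqr_signed_perm => i; apply: (@of_real_inj _ _ S).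
have := congr1 (fun t => tnth t i) (val_inj xs : sq x = _).
by rewrite !tnth_mktuple -!rmorphXn.
Qed.

(** The weak decomposition applied to the pair (X, X) supplies a diagonal, and sorting its absolute
    values is a signed permutation. *)
Lemma sigmaP m n (X : 'M[K]_(m, n)) : (m <= n)%N -> is_singular_values S X (sigma S X).
Proof.
move=> le_mn.
have [|| W [Z [x [_ [WW ZZ XE _]]]]] := @simultaneous_svd_weak _ _ S m n X X le_mn => //.
have [p [b [s0 s1]]] := signed_perm_sorted x.
suff : [set s | is_singular_values S X s] (signed_perm p b x) by exact: xgetI.
have [P [Q [PP QQ /(_ x) PxQ]]] := diag_block_signed_perm p b le_mn.
split=> //.
apply: (@char_poly_diag_block m n (W *m P^*h) (Z *m Q^*h)) => //.
- by apply: unitaryM => //; exact: unitary_adjoint.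
- by apply: unitaryM => //; exact: unitary_adjoint.
- rewrite PxQ XE adjointM adjointK !mulmxA -(mulmxA W P^*h) (unitaryC PP) mulmx1.
  by rewrite -(mulmxA _ Q^*h) (unitaryC QQ) // mulmx1.
Qed.

(** The signed permutation relating the diagonal of X to [sigma S X] is moved into the unitary
    factors, and the diagonal of D is transported backwards through the same one. *)
Lemma simultaneous_svd m n (X D : 'M[K]_(m, n)) : (m <= n)%N ->
  X *m D^*h = D *m X^*h -> X^*h *m D = D^*h *m X ->
  exists (W : 'M[K]_m) (Z : 'M[K]_n) (d : 'cV[R]_m),
  [/\ unitary S W, unitary S Z, X = W *m diag_block S n (sigma S X) *m Z^*h
    & D = W *m diag_block S n d *m Z^*h].
Proof.
move=> le_mn XD DX.
have [W [Z [x [d [WW ZZ XE DE]]]]] := simultaneous_svd_weak le_mn XD DX.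
have [p [b xE]] := is_singular_values_diag_block le_mn WW ZZ XE (sigmaP X le_mn).
have [P [Q [PP QQ PQ]]] := diag_block_signed_perm p b le_mn.
have [e dE] := signed_perm_inv p b d.
exists (W *m P), (Z *m Q), e; split; [exact: unitaryM|exact: unitaryM| |].
  by rewrite {1}XE {1}xE PQ adjointM !mulmxA.
by rewrite DE dE PQ adjointM !mulmxA.
Qed.

Lemma svd_pairs_neq0 m n (X : 'M[K]_(m, n)) : (m <= n)%N -> svd_pairs S X !=set0.
Proof.
move=> le_mn; have [|| W [Z [d [WW ZZ XE _]]]] := @simultaneous_svd m n X X le_mn => //.
by exists (W, Z).
Qed.

End SingularValues.

(** * Comparison of two singular value decompositions *)

(** On a finite index set the sum of all quotients is a uniform bound; a zero denominator
    contributes 0. *)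
Lemma uniform_ratio (R : realType) (T : finType) (f h : T -> R) :
  (forall t, h t = 0 -> f t = 0) -> exists2 c, 0 <= c & forall t, `|f t| <= c * `|h t|.
Proof.
move=> fh; exists (\sum_t `|f t| / `|h t|).
  by apply: sumr_ge0 => t _; rewrite divr_ge0.
move=> t; have [h0|h0] := eqVneq (h t) 0; first by rewrite fh // h0 !normr0 mulr0.
rewrite -ler_pdivrMr ?normr_gt0 // (bigD1 t) //= lerDl.
by apply: sumr_ge0 => i _; rewrite divr_ge0.
Qed.

Section Frame.
Variables (R : realType) (K : numFieldType) (S : real_or_complex R K).
Local Notation "A ^*h" := (adjoint S A) (at level 8, format "A ^*h").
Local Notation "`[ A ]" := (l1norm S A) (at level 0, A at level 99).

Lemma mul_mx_diag_block m n p (W : 'M[K]_(p, m)) (x : 'cV[R]_m) i j (le_mn : (m <= n)%N) :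
  (W *m diag_block S n x) i (widen_ord le_mn j) = W i j * of_real S (x j 0).
Proof.
rewrite mxE (bigD1 j) //= big1 => [|k kj]; first by rewrite addr0 diag_blockE eqxx.
by rewrite diag_blockE /= val_eqE (negPf kj) mulr0.
Qed.

Lemma mul_mx_diag_block_ge m n p (W : 'M[K]_(p, m)) (x : 'cV[R]_m) i (j : 'I_n) :
  (m <= j)%N -> (W *m diag_block S n x) i j = 0.
Proof.
move=> mj; rewrite mxE big1 // => k _; rewrite diag_blockE ltn_eqF ?mulr0 //.
exact: leq_trans (ltn_ord k) mj.
Qed.

Lemma mul_diag_block_mx m n p (y : 'cV[R]_m) (Z : 'M[K]_(n, p)) i j (le_mn : (m <= n)%N) :
  (diag_block S n y *m Z) i j = of_real S (y i 0) * Z (widen_ord le_mn i) j.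
Proof.
rewrite mxE (bigD1 (widen_ord le_mn i)) //= big1 => [|k ki].
  by rewrite addr0 diag_blockE eqxx.
by rewrite diag_blockE; case: eqP => [ik|]; rewrite ?mul0r //;
  rewrite -val_eqE /= -ik eqxx in ki.
Qed.

Section Estimates.
Variables (m n : nat) (le_mn : (m <= n)%N) (U U' : 'M[K]_m) (V V' : 'M[K]_n).
Hypotheses (UU : unitary S U) (UU' : unitary S U') (VV : unitary S V) (VV' : unitary S V').
Let W := U'^*h *m U.
Let Z := V'^*h *m V.
Let wd := widen_ord le_mn.

Definition svd_diff (x y : 'cV[R]_m) :=
  U *m diag_block S n x *m V^*h - U' *m diag_block S n y *m V'^*h.

Let svd_diff_frame x y :
  U'^*h *m svd_diff x y *m V = W *m diag_block S n x - diag_block S n y *m Z.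
Proof.
rewrite /svd_diff mulmxBr mulmxBl !mulmxA -(mulmxA _ V^*h V) (unitaryC VV) mulmx1.
by rewrite (unitaryC UU') mul1mx -mulmxA.
Qed.

Lemma svd_diff_frame_entry x y i j :
  (U'^*h *m svd_diff x y *m V) i (wd j) =
  W i j * of_real S (x j 0) - of_real S (y i 0) * Z (wd i) (wd j).
Proof.
by rewrite svd_diff_frame [LHS]mxE mul_mx_diag_block [X in _ + X]mxE (mul_diag_block_mx _ _ _ _ le_mn).
Qed.

Lemma svd_diff_frame_entry_ge x y i (j : 'I_n) : (m <= j)%N ->
  (U'^*h *m svd_diff x y *m V) i j = - (of_real S (y i 0) * Z (wd i) j).
Proof.
move=> mj; rewrite svd_diff_frame [LHS]mxE mul_mx_diag_block_ge // add0r.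
by rewrite [LHS]mxE (mul_diag_block_mx _ _ _ _ le_mn).
Qed.

Lemma svd_diff_adjoint_frame_entry x y i j :
  (V'^*h *m (svd_diff x y)^*h *m U) (wd i) j =
  Z (wd i) (wd j) * of_real S (x j 0) - of_real S (y i 0) * W i j.
Proof.
have -> : V'^*h *m (svd_diff x y)^*h *m U =
    Z *m (diag_block S n x)^*h - (diag_block S n y)^*h *m W.
  rewrite /svd_diff raddfB /= !adjointM !adjointK mulmxBr mulmxBl !mulmxA.
  rewrite -(mulmxA _ U^*h U) (unitaryC UU) mulmx1.
  by rewrite (unitaryC VV') mul1mx -mulmxA.
have -> : Z *m (diag_block S n x)^*h = (diag_block S n x *m Z^*h)^*h.
  by rewrite adjointM adjointK.
have -> : (diag_block S n y)^*h *m W = (W^*h *m diag_block S n y)^*h.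
  by rewrite adjointM adjointK.
rewrite [LHS]mxE [X in _ + X]mxE !adjointE mul_mx_diag_block (mul_diag_block_mx _ _ _ _ le_mn).
by rewrite !rmorphM /= !conj_of_real !adjointE !conj_scalarK mulrC [X in _ - X]mulrC.
Qed.

Let entry_le1 k (P : 'M[K]_k) i j : unitary S P -> modulus S (P i j) <= 1.
Proof. exact: unitary_entry. Qed.

Lemma svd_diff_entry_le x y i j :
  modulus S ((U'^*h *m svd_diff x y *m V) i j) <= `[svd_diff x y].
Proof.
by apply: unitary_mul_entry => ? ?; apply: entry_le1 => //; exact: unitary_adjoint.
Qed.

Lemma svd_diff_adjoint_entry_le x y i j :
  modulus S ((V'^*h *m (svd_diff x y)^*h *m U) i j) <= `[svd_diff x y].
Proof.
rewrite -(l1norm_adjoint S (svd_diff x y)).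
by apply: unitary_mul_entry => ? ?; apply: entry_le1 => //; exact: unitary_adjoint.
Qed.

(* The entries of U'^* M V and of V'^* M^* U are W x - y Z and Z x - y W; their
   sum and difference decouple into (W + Z)(x - y) and (W - Z)(x + y). *)
Lemma frame_sum_le (x y : 'cV[R]_m) i j :
  modulus S (W i j + Z (wd i) (wd j)) * `|x j 0 - y i 0| <= 2 * `[svd_diff x y].
Proof.
rewrite -(modulus_of_real S) -modulusM.
have -> : (W i j + Z (wd i) (wd j)) * of_real S (x j 0 - y i 0) =
    (U'^*h *m svd_diff x y *m V) i (wd j) + (V'^*h *m (svd_diff x y)^*h *m U) (wd i) j.
  by rewrite svd_diff_frame_entry svd_diff_adjoint_frame_entry rmorphB /=; ring.
apply: le_trans (ler_modulusD _ _ _) _; rewrite mulr_natl mulr2n.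
by apply: lerD; [exact: svd_diff_entry_le|exact: svd_diff_adjoint_entry_le].
Qed.

Lemma frame_diff_le (x y : 'cV[R]_m) i j :
  modulus S (W i j - Z (wd i) (wd j)) * `|x j 0 + y i 0| <= 2 * `[svd_diff x y].
Proof.
rewrite -(modulus_of_real S) -modulusM.
have -> : (W i j - Z (wd i) (wd j)) * of_real S (x j 0 + y i 0) =
    (U'^*h *m svd_diff x y *m V) i (wd j) - (V'^*h *m (svd_diff x y)^*h *m U) (wd i) j.
  by rewrite svd_diff_frame_entry svd_diff_adjoint_frame_entry rmorphD /=; ring.
apply: le_trans (ler_modulusD _ _ _) _; rewrite mulr_natl mulr2n modulusN.
by apply: lerD; [exact: svd_diff_entry_le|exact: svd_diff_adjoint_entry_le].
Qed.

Let W_le1 i j : modulus S (W i j) <= 1.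
Proof. by apply: entry_le1; apply: unitaryM => //; exact: unitary_adjoint. Qed.

Let Z_le1 i j : modulus S (Z i j) <= 1.
Proof. by apply: entry_le1; apply: unitaryM => //; exact: unitary_adjoint. Qed.

(** An entry W a_j - b_i Z equals half of (W + Z)(a_j - b_i) + (W - Z)(a_j + b_i), so the hypotheses
    on differences and sums combine with [frame_sum_le] and [frame_diff_le]. The hypothesis on b
    alone treats the columns from m on. The slack e leaves room for x and y to be different
    vectors. *)
Lemma svd_diff_lipschitz (x y a b : 'cV[R]_m) (c e : R) : 0 <= c -> 0 <= e ->
  (forall i j, `|a j 0 - b i 0| <= c * `|x j 0 - y i 0| + e) ->
  (forall i j, `|a j 0 + b i 0| <= c * `|x j 0 + y i 0| + e) ->
  (forall i, `|b i 0| <= c * `|y i 0|) ->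
  `[svd_diff a b] <= ((m * n) ^ 2)%:R * (2 * c * `[svd_diff x y] + 2 * e).
Proof.
move=> c0 e0 abB abD bi.
rewrite -[X in `[X]](unitary_mulK _ UU' (unitary_adjoint VV)) adjointK.
apply: le_trans (unitary_mul_l1norm _ _ _) _ => //; first exact: unitary_adjoint.
rewrite natrX expr2 -mulrA ler_wpM2l //; apply: l1norm_le => i j.
have N0 := l1norm_ge0 S (svd_diff x y).
have [mj|jm] := leqP m j.
  rewrite svd_diff_frame_entry_ge // modulusN modulusM modulus_of_real.
  have := svd_diff_entry_le x y i j.
  rewrite svd_diff_frame_entry_ge // modulusN modulusM modulus_of_real.
  have := bi i; have := modulus_ge0 S (Z (wd i) j); nra.
have -> : j = wd (Ordinal jm) by exact/val_inj.
move: (Ordinal jm) => {jm}j; rewrite svd_diff_frame_entry.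
have -> : W i j * of_real S (a j 0) - of_real S (b i 0) * Z (wd i) (wd j) =
  of_real S (2^-1) * ((W i j + Z (wd i) (wd j)) * of_real S (a j 0 - b i 0)
   + (W i j - Z (wd i) (wd j)) * of_real S (a j 0 + b i 0)).
  by rewrite rmorphB rmorphD fmorphV rmorph_nat /=; field.
rewrite modulusM modulus_of_real ger0_norm ?invr_ge0 //.
apply: le_trans (ler_wpM2l _ (ler_modulusD _ _ _)) _; first by rewrite invr_ge0.
rewrite !modulusM !modulus_of_real.
have := frame_sum_le x y i j; have := frame_diff_le x y i j.
have WZ1 := ler_modulusD S (W i j) (Z (wd i) (wd j)).
have WZ2 := ler_modulusD S (W i j) (- Z (wd i) (wd j)); rewrite modulusN in WZ2.
move: WZ1 WZ2 (W_le1 i j) (Z_le1 (wd i) (wd j)) (abB i j) (abD i j).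
move: (modulus_ge0 S (W i j + Z (wd i) (wd j))) (modulus_ge0 S (W i j - Z (wd i) (wd j))).
move: (modulus S (W i j + _)) (modulus S (W i j - _)) => P Q P0 Q0.
move: (modulus S (W i j)) (modulus S (Z _ _)) => w z WZ1 WZ2 w1 z1.
move: `|a j 0 - b i 0| `|a j 0 + b i 0| `|x j 0 - y i 0| `|x j 0 + y i 0| => A B X Y hA hB hY hX.
have hP : P * A <= P * (c * X + e) by exact: ler_wpM2l.
have hQ : Q * B <= Q * (c * Y + e) by exact: ler_wpM2l.
have hX' : c * (P * X) <= c * (2 * `[svd_diff x y]) by exact: ler_wpM2l.
have hY' : c * (Q * Y) <= c * (2 * `[svd_diff x y]) by exact: ler_wpM2l.
have hPe : P * e <= 2 * e by rewrite ler_wpM2r //; lra.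
have hQe : Q * e <= 2 * e by rewrite ler_wpM2r //; lra.
nra.
Qed.

(* The first k+1 columns of the unitary matrix W cannot be supported on its
   first k rows, so some entry W i j with j <= k <= i is not small. *)
Lemma weyl_one_sided (x y : 'cV[R]_m) k :
  (forall i j : 'I_m, (i <= j)%N -> x j 0 <= x i 0) ->
  (forall i j : 'I_m, (i <= j)%N -> y j 0 <= y i 0) -> (forall i, 0 <= y i 0) ->
  x k 0 - y k 0 <= 2 * m%:R * `[svd_diff x y].
Proof.
move=> xs ys y0; have N0 := l1norm_ge0 S (svd_diff x y).
have [xy|xy] := leP (x k 0 - y k 0) 0.
  by apply: le_trans xy _; rewrite !mulr_ge0.
set d := x k 0 - y k 0 in xy *; set N := `[_] in N0 *.
have WW : unitary S W by apply: unitaryM => //; exact: unitary_adjoint.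
(* For j <= k <= i the ordering gives x_j - y_i >= d, and y >= 0 gives x_j + y_i >= d. Hence W + Z
   and W - Z, and so W, are controlled by N / d at the entry (i, j). *)
have small (i j : 'I_m) : (j <= k)%N -> (k <= i)%N -> (modulus S (W i j) * d) ^+ 2 <= (2 * N) ^+ 2.
  move=> jk ki; rewrite ler_pXn2r // ?nnegrE ?mulr_ge0 ?modulus_ge0 ?(ltW xy) //.
  have := frame_sum_le x y i j; have := frame_diff_le x y i j; rewrite -/N.
  have := ler_modulusD S (W i j + Z (wd i) (wd j)) (W i j - Z (wd i) (wd j)).
  have -> : W i j + Z (wd i) (wd j) + (W i j - Z (wd i) (wd j)) = of_real S 2 * W i j.
    by rewrite rmorph_nat; ring.
  rewrite modulusM modulus_of_real ger0_norm //.
  move: (modulus_ge0 S (W i j + Z (wd i) (wd j))) (modulus_ge0 S (W i j - Z (wd i) (wd j))).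
  move: (modulus S (W i j + _)) (modulus S (W i j - _)) => P Q P0 Q0 PQ.
  have := xs _ _ jk; have := ys _ _ ki; have := y0 i; have := y0 k => yk yi yki xjk.
  have xjd : d <= `|x j 0 - y i 0| by apply: le_trans (ler_norm _); rewrite /d; lra.
  have xjd' : d <= `|x j 0 + y i 0| by apply: le_trans (ler_norm _); rewrite /d; lra.
  have hP : P * d <= P * `|x j 0 - y i 0| by exact: ler_wpM2l.
  have hQ : Q * d <= Q * `|x j 0 + y i 0| by exact: ler_wpM2l.
  have hPQ : (2 * modulus S (W i j)) * d <= (P + Q) * d by rewrite ler_wpM2r // ltW.
  lra.
pose w i j := modulus S (W i j) ^+ 2.
have w0 i j : 0 <= w i j by rewrite exprn_ge0 ?modulus_ge0.
have big1' : 1 <= \sum_(j < m | (j <= k)%N) \sum_(i < m | (k <= i)%N) w i j.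
  have E : \sum_(j < m | (j <= k)%N) \sum_i w i j =
      \sum_(j < m | (j <= k)%N) \sum_(i < m | (k <= i)%N) w i j +
      \sum_(j < m | (j <= k)%N) \sum_(i < m | (i < k)%N) w i j.
    rewrite -big_split /=; apply: eq_bigr => j _.
    rewrite (bigID (fun i : 'I_m => k <= i)%N) /=; congr (_ + _).
    by apply: eq_bigl => i; rewrite ltnNge.
  have E1 : \sum_(j < m | (j <= k)%N) \sum_i w i j =
      1 + \sum_(i < m | (i < k)%N) (1 : R).
    under eq_bigr => j _ do rewrite (unitary_col j WW).
    rewrite (bigD1 k) //=; congr (_ + _); apply: eq_bigl => i.
    by rewrite ltn_neqAle andbC.
  have E2 : \sum_(j < m | (j <= k)%N) \sum_(i < m | (i < k)%N) w i j <=
      \sum_(i < m | (i < k)%N) (1 : R).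
    rewrite exchange_big /=; apply: ler_sum => i _.
    rewrite -(unitary_row i WW) [leRHS](bigID (fun j : 'I_m => j <= k)%N) /= lerDl.
    by apply: sumr_ge0 => j _; exact: w0.
  lra.
(* The corner has at most m^2 entries, so d^2 <= m^2 (2 N)^2. *)
rewrite -(@ler_pXn2r _ 2) // ?nnegrE ?mulr_ge0 ?(ltW xy) //.
apply: le_trans (_ : \sum_(j < m) \sum_(i < m) (2 * N) ^+ 2 <= _).
  apply: le_trans (_ : \sum_(j < m | (j <= k)%N) \sum_(i < m | (k <= i)%N) (w i j * d ^+ 2) <= _).
    under eq_bigr => j _ do rewrite -mulr_suml.
    by rewrite -mulr_suml ler_peMl // exprn_ge0 // ltW.
  apply: le_trans (_ : \sum_(j < m | (j <= k)%N) \sum_(i < m | (k <= i)%N) (2 * N) ^+ 2 <= _).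
    by apply: ler_sum => j jk; apply: ler_sum => i ki; rewrite -exprMn small.
  rewrite [leRHS](bigID (fun j : 'I_m => j <= k)%N) /= -[leLHS]addr0 lerD //.
    apply: ler_sum => j jk; rewrite [leRHS](bigID (fun i : 'I_m => k <= i)%N) /= lerDl.
    by apply: sumr_ge0 => i _; rewrite exprn_ge0 // mulr_ge0.
  by do 2![apply: sumr_ge0 => ? _]; rewrite exprn_ge0 // mulr_ge0.
rewrite !sumr_const !card_ord -mulrnA -[leLHS]mulr_natr natrM; lra.
Qed.

End Estimates.

Lemma weyl m n (U U' : 'M[K]_m) (V V' : 'M[K]_n) (x y : 'cV[R]_m) k : (m <= n)%N ->
  unitary S U -> unitary S U' -> unitary S V -> unitary S V' ->
  (forall i j : 'I_m, (i <= j)%N -> x j 0 <= x i 0) -> (forall i, 0 <= x i 0) ->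
  (forall i j : 'I_m, (i <= j)%N -> y j 0 <= y i 0) -> (forall i, 0 <= y i 0) ->
  `|x k 0 - y k 0| <= 2 * m%:R *
    `[U *m diag_block S n x *m V^*h - U' *m diag_block S n y *m V'^*h].
Proof.
move=> le_mn UU UU' VV VV' xs x0 ys y0; rewrite ler_norml; apply/andP; split.
  rewrite lerNl opprB l1normBC; exact: (weyl_one_sided le_mn).
exact: (weyl_one_sided le_mn).
Qed.

End Frame.

(** * Consequences of absolute symmetry *)

Section RealVectors.
Variables (R : realType) (m : nat).
Implicit Types (x y : 'cV[R]_m) (p : 'S_m) (b : 'I_m -> bool).
Local Notation "`[ x ]" := (l1norm RealField x) (at level 0, x at level 99).

Lemma col_entry_le x i : `|x i 0| <= `[x].
Proof. by rewrite -(modulus_of_real RealField); exact: l1norm_entry. Qed.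

Lemma col_l1norm_le x c : (forall i, `|x i 0| <= c) -> `[x] <= m%:R * c.
Proof.
move=> xc; have := @l1norm_le _ _ RealField m 1 x c; rewrite muln1; apply=> i j.
by rewrite ord1 (modulus_of_real RealField); exact: xc.
Qed.

Lemma l1norm_signed_perm p b x : `[signed_perm p b x] = `[x].
Proof.
rewrite /l1norm [RHS](reindex_inj (@perm_inj _ p)); apply: eq_bigr => i _.
apply: eq_bigr => j _; rewrite mxE modulusM ord1 (modulus_of_real RealField ((-1) ^+ b i)).
by rewrite normrX normrN1 expr1n mul1r.
Qed.

Definition transpose x i j : 'cV[R]_m := signed_perm (tperm i j) (fun=> false) x.

(** For i = j this flips the sign of one entry, which is how symmetry forces g(x)_i = 0 when x_i =
    0. *)
Definition swap_neg x i j : 'cV[R]_m :=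
  signed_perm (tperm i j) (fun k => (k == i) || (k == j)) x.

Lemma transpose_entry x i j k :
  transpose x i j k 0 = if k == i then x j 0 else if k == j then x i 0 else x k 0.
Proof.
rewrite mxE mul1r; case: tpermP => [->|->|/eqP/negPf-> /eqP/negPf->] //.
- by rewrite eqxx.
- by rewrite eqxx; have [->|] := eqVneq j i.
Qed.

Lemma swap_neg_entry x i j k : swap_neg x i j k 0 =
  if k == i then - x j 0 else if k == j then - x i 0 else x k 0.
Proof.
rewrite mxE; case: tpermP => [->|->|/eqP/negPf-> /eqP/negPf->] /=.
- by rewrite eqxx mulN1r.
- by rewrite eqxx orbT mulN1r; have [->|] := eqVneq j i.
- by rewrite mul1r.
Qed.

Variables (D : set 'cV[R]_m) (g : 'cV[R]_m -> 'cV[R]_m).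
Hypothesis g_sym : absolutely_symmetric D g.

Lemma abs_sym_eq x i j : D x -> x j 0 = x i 0 -> g x j 0 = g x i 0.
Proof.
move=> Dx xij; have tx : transpose x i j = x.
  apply/colP => k; rewrite transpose_entry; have [->//|_] := eqVneq k i.
  by have [->|] := eqVneq k j.
rewrite -[in RHS]tx (abs_sym_signed_perm _ _ g_sym Dx) -/(transpose (g x) i j).
by rewrite transpose_entry eqxx.
Qed.

Lemma abs_sym_opp x i j : D x -> x j 0 = - x i 0 -> g x j 0 = - g x i 0.
Proof.
move=> Dx xij; have tx : swap_neg x i j = x.
  apply/colP => k; rewrite swap_neg_entry; have [->|_] := eqVneq k i.
    by rewrite xij opprK.
  by have [->|] := eqVneq k j.
rewrite -[in RHS]tx (abs_sym_signed_perm _ _ g_sym Dx) -/(swap_neg (g x) i j).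
by rewrite swap_neg_entry eqxx opprK.
Qed.

End RealVectors.

Section WellDefined.
Variables (R : realType) (K : numFieldType) (S : real_or_complex R K).
Variables (m n : nat) (le_mn : (m <= n)%N).
Variables (D : set 'cV[R]_m) (g : 'cV[R]_m -> 'cV[R]_m).
Hypothesis g_sym : absolutely_symmetric D g.
Local Notation "A ^*h" := (adjoint S A) (at level 8, format "A ^*h").
Local Notation "`[ A ]" := (l1norm S A) (at level 0, A at level 99).

(** After a signed permutation both decompositions have diagonal s. Symmetry makes g(s)_j - g(s)_i
    and g(s)_j + g(s)_i vanish together with the same expressions in s, so [svd_diff_lipschitz]
    applies without slack, and a zero difference before g stays zero after g. The diagonal y may be
    unsorted or have negative entries. *)
Lemma spectral_operator_svd (X : 'M[K]_(m, n)) W Z (y : 'cV[R]_m) :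
  D (sigma S X) -> unitary S W -> unitary S Z -> X = W *m diag_block S n y *m Z^*h ->
  spectral_operator S g X = W *m diag_block S n (g y) *m Z^*h.
Proof.
move=> DX WW ZZ XE; set s := sigma S X in DX.
have [p [b yE]] := is_singular_values_diag_block le_mn WW ZZ XE (sigmaP S X le_mn).
have [P [Q [PP QQ PQ]]] := diag_block_signed_perm S p b le_mn.
rewrite yE (abs_sym_signed_perm _ _ g_sym DX) PQ /spectral_operator -/s.
case: (xgetPex (1%:M, 1%:M) (svd_pairs_neq0 S X le_mn)).
move: (xget _ _) => [U V] /= UU VV XE'.
have [|c1 c10 c1P] := @uniform_ratio R ('I_m * 'I_m)%type
    (fun ij => g s ij.2 0 - g s ij.1 0) (fun ij => s ij.2 0 - s ij.1 0).
  move=> ij /eqP; rewrite subr_eq0 => /eqP/(abs_sym_eq g_sym DX) ->.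
  exact: subrr.
have [|c2 c20 c2P] := @uniform_ratio R ('I_m * 'I_m)%type
    (fun ij => g s ij.2 0 + g s ij.1 0) (fun ij => s ij.2 0 + s ij.1 0).
  move=> ij /eqP; rewrite addr_eq0 => /eqP/(abs_sym_opp g_sym DX) ->.
  exact: addNr.
have WP : unitary S (W *m P) by exact: unitaryM.
have ZQ : unitary S (Z *m Q) by exact: unitaryM.
have : `[svd_diff S U (W *m P) V (Z *m Q) (g s) (g s)] <=
    ((m * n) ^ 2)%:R * (2 * (c1 + c2) * `[svd_diff S U (W *m P) V (Z *m Q) s s] + 2 * 0).
  apply: svd_diff_lipschitz => //; first exact: addr_ge0.
  - move=> i j; rewrite addr0; apply: le_trans (c1P (i, j)) _.
    by rewrite ler_wpM2r // lerDl.
  - move=> i j; rewrite addr0; apply: le_trans (c2P (i, j)) _.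
    by rewrite ler_wpM2r // lerDr.
  - move=> i; have := c2P (i, i); rewrite /= -!mulr2n !normrMn.
    rewrite mulrnAr lerMn2r /= => h; apply: le_trans h _.
    by rewrite ler_wpM2r // lerDr.
have -> : svd_diff S U (W *m P) V (Z *m Q) s s = 0.
  rewrite /svd_diff -XE' adjointM !mulmxA XE yE PQ !mulmxA; exact: subrr.
rewrite l1norm0 !mulr0 addr0 mulr0 => h.
have /l1norm_eq0/eqP : `[svd_diff S U (W *m P) V (Z *m Q) (g s) (g s)] = 0.
  by apply/eqP; rewrite eq_le h l1norm_ge0.
by rewrite /svd_diff subr_eq0 => /eqP ->; rewrite adjointM !mulmxA.
Qed.

End WellDefined.

(** * Bounds for g near s that respect clusters of entries *)

Section LocalBounds.
Variables (R : realType) (m : nat) (D : set 'cV[R]_m) (g : 'cV[R]_m -> 'cV[R]_m).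
Variable (s : 'cV[R]_m).
Hypotheses (D_open : open D) (Ds : D s) (g_sym : absolutely_symmetric D g).
Hypothesis g_lip : locally_lipschitz_near RealField g s.
Local Notation "`[ x ]" := (l1norm RealField x) (at level 0, x at level 99).

Lemma lipschitz_l1norm : exists r c : R, [/\ 0 < r, 0 <= c,
  forall x, `[x - s] < r -> D x &
  forall x y, `[x - s] < r -> `[y - s] < r -> `[g x - g y] <= c * `[x - y]].
Proof.
have [A [L [Ao As AL]]] := g_lip.
have [r1 r10 r1P] := (nbhs_l1norm RealField s D).1 (open_nbhs_nbhs (conj D_open Ds)).
have [r2 r20 r2P] := (nbhs_l1norm RealField s A).1 (open_nbhs_nbhs (conj Ao As)).
exists (Num.min r1 r2), ((m * 1)%:R * `|L|); rewrite lt_min r10 r20 mulr_ge0 //.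
split=> // [x|x y]; rewrite !lt_min; first by move=> /andP[/r1P].
move=> /andP[_ /r2P Ax] /andP[_ /r2P Ay].
apply: le_trans (l1norm_le_frob _ _) _; rewrite -mulrA ler_wpM2l //.
apply: le_trans (AL _ _ Ax Ay) _.
apply: le_trans (ler_wpM2r (frob_norm_ge0 _ _) (ler_norm L)) _.
by rewrite ler_wpM2l // frob_le_l1norm.
Qed.

(** If s_i = s_j, transposing x keeps its distance to s, and the Lipschitz bound between x and its
    transpose controls g(x)_j - g(x)_i. If s_i and s_j differ, x_j - x_i is bounded away from 0 and
    boundedness of g suffices. Entries near 0 are treated alike, with a sign flip. *)
Lemma local_symmetric_bounds : exists r c : R, [/\ 0 < r, 0 <= c,
  forall x, `[x - s] < r -> D x,
  forall x y, `[x - s] < r -> `[y - s] < r -> `[g x - g y] <= c * `[x - y] &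
  forall x, `[x - s] < r ->
    (forall i j, `|g x j 0 - g x i 0| <= c * `|x j 0 - x i 0|) /\
    (forall i, `|g x i 0| <= c * `|x i 0|)].
Proof.
have [r0 [L [r00 L0 rD rL]]] := lipschitz_l1norm.
(* Both constants invert gaps: c1 |s_j - s_i| >= 1 for distinct entries, and c2 |s_i| >= 1 for
   nonzero ones. *)
have [|c1 c10 c1P] := @uniform_ratio R ('I_m * 'I_m)%type
    (fun ij => (s ij.2 0 != s ij.1 0)%:R) (fun ij => s ij.2 0 - s ij.1 0).
  by move=> ij /eqP; rewrite subr_eq0 => ->.
have [|c2 c20 c2P] := @uniform_ratio R 'I_m
    (fun i => (s i 0 != 0)%:R) (fun i => s i 0).
  by move=> i ->; rewrite eqxx.
(* Passing from s to x loses at most 2 r in a gap, and 2 r c1 <= 1/2, so 2 c1 |x_j - x_i| >= 1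
   persists; likewise for c2. *)
pose r := Num.min r0 (4 * (c1 + c2 + 1))^-1.
have cpos : 0 < 4 * (c1 + c2 + 1) by lra.
have r_gt0 : 0 < r by rewrite lt_min r00 invr_gt0.
have rr0 : r <= r0 by rewrite ge_min lexx.
have rc : r * (4 * (c1 + c2 + 1)) <= 1.
  by rewrite -ler_pdivlMr // div1r ge_min lexx orbT.
pose B := `[g s] + L * r0.
have B0 : 0 <= B by rewrite addr_ge0 ?l1norm_ge0 ?mulr_ge0 // ltW.
have gB x i : `[x - s] < r -> `|g x i 0| <= B.
  move=> xr; apply: le_trans (col_entry_le _ _) _.
  have xr0 := lt_le_trans xr rr0.
  rewrite -[g x](subrK (g s)); apply: le_trans (ler_l1normD _ _ _) _.
  rewrite addrC lerD2l; apply: le_trans (rL _ _ xr0 _) _; first by rewrite subrr l1norm0.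
  by rewrite ler_wpM2l // ltW.
(* The first summand covers coinciding entries and the plain Lipschitz bound. The second comes from
   2 B <= 4 B c1 |x_j - x_i| across a gap, and from B <= 2 B c2 |x_i|. *)
pose c := L * (m%:R + 1) + 4 * B * (c1 + c2).
have Lm0 : 0 <= L * m%:R by rewrite mulr_ge0.
have Bc1 : 0 <= B * c1 by rewrite mulr_ge0.
have Bc2 : 0 <= B * c2 by rewrite mulr_ge0.
exists r, c; split => //.
- by rewrite /c; lra.
- by move=> x /lt_le_trans/(_ rr0)/rD.
- move=> x y xr yr; apply: le_trans (rL _ _ (lt_le_trans xr rr0) (lt_le_trans yr rr0)) _.
  by rewrite ler_wpM2r ?l1norm_ge0 // /c; lra.
move=> x xr; have xr0 := lt_le_trans xr rr0; have Dx := rD _ xr0.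
have xs i : `|x i 0 - s i 0| <= r.
  by have := col_entry_le (x - s) i; rewrite !mxE => /le_trans -> //; exact: ltW.
split=> [i j|i].
  have [sij|sij] := eqVneq (s j 0) (s i 0).
    have tr0 : `[transpose x i j - s] < r0.
      have -> : s = transpose s i j.
        apply/colP => k; rewrite transpose_entry; have [->//|_] := eqVneq k i.
        by have [->|] := eqVneq k j.
      by rewrite -signed_permB l1norm_signed_perm.
    have := col_entry_le (g x - g (transpose x i j)) i.
    rewrite (abs_sym_signed_perm _ _ g_sym Dx) -/(transpose (g x) i j).
    rewrite [X in `|X|]mxE [X in _ + X]mxE transpose_entry eqxx distrC => /le_trans; apply.
    rewrite /transpose -(abs_sym_signed_perm _ _ g_sym Dx).
    apply: le_trans (rL _ _ xr0 tr0) _.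
    have : `[x - transpose x i j] <= m%:R * `|x j 0 - x i 0|.
      apply: col_l1norm_le => k; rewrite !mxE -/(transpose x i j k 0).
      have := transpose_entry x i j k; rewrite mxE => ->.
      have [->|_] := eqVneq k i; first by rewrite distrC.
      by have [->//|_] := eqVneq k j; rewrite subrr normr0.
    move=> /(ler_wpM2l L0) h; apply: le_trans h _.
    by rewrite mulrA ler_wpM2r // /c; lra.
  have := c1P (i, j); rewrite /= sij normr1 => h1.
  have hx : `|s j 0 - s i 0| <= `|x j 0 - x i 0| + 2 * r.
    have -> : s j 0 - s i 0 = (x j 0 - x i 0) - (x j 0 - s j 0) + (x i 0 - s i 0) by ring.
    apply: le_trans (ler_normD _ _) _; have := ler_normB (x j 0 - x i 0) (x j 0 - s j 0).
    have := xs i; have := xs j; lra.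
  have h2 : 1 <= 2 * (c1 * `|x j 0 - x i 0|).
    have := le_trans h1 (ler_wpM2l c10 hx); have : 0 <= r * c2 by rewrite mulr_ge0 // ltW.
    lra.
  apply: le_trans (ler_normB _ _) _; apply: le_trans (lerD (gB _ j xr) (gB _ i xr)) _.
  have := ler_wpM2l B0 h2.
  have : 0 <= (L * (m%:R + 1) + 4 * B * c2) * `|x j 0 - x i 0|.
    by rewrite mulr_ge0 //; lra.
  by rewrite /c; lra.
have [si|si] := eqVneq (s i 0) 0.
  have tr0 : `[swap_neg x i i - s] < r0.
    have -> : s = swap_neg s i i.
      apply/colP => k; rewrite swap_neg_entry; have [->|//] := eqVneq k i.
      by rewrite si oppr0.
    by rewrite -signed_permB l1norm_signed_perm.
  have := col_entry_le (g x - g (swap_neg x i i)) i.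
  rewrite (abs_sym_signed_perm _ _ g_sym Dx) -/(swap_neg (g x) i i).
  rewrite [X in `|X|]mxE [X in _ + X]mxE swap_neg_entry eqxx opprK.
  rewrite /swap_neg -(abs_sym_signed_perm _ _ g_sym Dx) => h.
  have := le_trans h (rL _ _ xr0 tr0).
  have : `[x - swap_neg x i i] <= m%:R * (2 * `|x i 0|).
    apply: col_l1norm_le => k; rewrite !mxE -/(swap_neg x i i k 0).
    have := swap_neg_entry x i i k; rewrite mxE => ->.
    have [->|_] := eqVneq k i; first by rewrite opprK -mulr2n normrMn mulr_natl.
    by rewrite subrr normr0 mulr_ge0.
  move=> /(ler_wpM2l L0); rewrite -mulr2n normrMn -mulr_natl => h1 h2.
  have : 0 <= (L + 4 * B * (c1 + c2)) * `|x i 0| by rewrite mulr_ge0 //; lra.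
  by rewrite /c; lra.
have := c2P i; rewrite /= si normr1 => h1.
have hx : `|s i 0| <= `|x i 0| + r.
  rewrite -[s i 0](subKr (x i 0)); apply: le_trans (ler_normB _ _) _.
  by have := xs i; lra.
have h2 : 1 <= 2 * (c2 * `|x i 0|).
  have := le_trans h1 (ler_wpM2l c20 hx); have : 0 <= r * c1 by rewrite mulr_ge0 // ltW.
  lra.
apply: le_trans (gB _ i xr) _; have := ler_wpM2l B0 h2.
have : 0 <= (L * (m%:R + 1) + 4 * B * c1 + 2 * B * c2) * `|x i 0|.
  by rewrite mulr_ge0 //; lra.
by rewrite /c; lra.
Qed.

End LocalBounds.

(** * Lipschitz continuity and the Cayley transform *)

Section SpectralLipschitz.
Variables (R : realType) (K : numFieldType) (S : real_or_complex R K).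
Variables (m n : nat) (le_mn : (m <= n)%N).
Local Notation "A ^*h" := (adjoint S A) (at level 8, format "A ^*h").
Local Notation "`[ A ]" := (l1norm S A) (at level 0, A at level 99).

Lemma svd_exists (X : 'M[K]_(m, n)) : exists (U : 'M[K]_m) (V : 'M[K]_n),
  [/\ unitary S U, unitary S V & X = U *m diag_block S n (sigma S X) *m V^*h].
Proof. by have [[U V] [? ? ?]] := svd_pairs_neq0 S X le_mn; exists U, V. Qed.

Lemma sigma_lipschitz (X Y : 'M[K]_(m, n)) :
  l1norm RealField (sigma S X - sigma S Y) <= m%:R * (2 * m%:R * `[X - Y]).
Proof.
have [U [V [UU VV XE]]] := svd_exists X; have [U' [V' [UU' VV' YE]]] := svd_exists Y.
have [x0 xs _] := sigmaP S X le_mn; have [y0 ys _] := sigmaP S Y le_mn.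
have XYE : X - Y = U *m diag_block S n (sigma S X) *m V^*h
    - U' *m diag_block S n (sigma S Y) *m V'^*h.
  by congr (_ - _); [exact: XE | exact: YE].
apply: col_l1norm_le => i; rewrite !mxE [X - Y]XYE.
exact: (weyl i le_mn UU UU' VV VV' xs x0 ys y0).
Qed.

(** The singular vectors of X and Y may be far apart, so x_j has to be compared with y_i for all i
    and j. Going through g(y)_j splits g(x)_j - g(y)_i into a Lipschitz term, which
    [sigma_lipschitz] bounds by the slack, and a difference of entries of g(y). *)
Lemma spectral_operator_lipschitz (D : set 'cV[R]_m) g (Xbar : 'M[K]_(m, n)) :
  open D -> D (sigma S Xbar) -> absolutely_symmetric D g ->
  locally_lipschitz_near RealField g (sigma S Xbar) ->
  exists r c : R, [/\ 0 < r, 0 <= c & forall X Y, `[X - Xbar] < r -> `[Y - Xbar] < r ->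
    `[spectral_operator S g X - spectral_operator S g Y] <= c * `[X - Y]].
Proof.
move=> D_open Ds g_sym g_lip.
have [r [c [r0 c0 rD rL rS]]] := local_symmetric_bounds D_open Ds g_sym g_lip.
pose k : R := m%:R * (2 * m%:R); have k0 : 0 <= k by rewrite !mulr_ge0.
pose r' := r / (k + 1); have r'0 : 0 < r' by rewrite divr_gt0 // ltr_wpDl.
exists r', (((m * n) ^ 2)%:R * (2 * c + 2 * (2 * c * k))).
split=> [//||X Y Xr Yr]; first by rewrite !(mulr_ge0, addr_ge0).
have near T : `[T - Xbar] < r' -> l1norm RealField (sigma S T - sigma S Xbar) < r.
  move=> Tr; apply: le_lt_trans (sigma_lipschitz _ _) _.
  rewrite mulrA -/k; apply: le_lt_trans (_ : k * r' < _).
    by rewrite ler_wpM2l // ltW.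
  by rewrite /r' mulrCA gtr_pMr // ltr_pdivrMr; lra.
have [U [V [UU VV XE]]] := svd_exists X; have [U' [V' [UU' VV' YE]]] := svd_exists Y.
have [x0 xs _] := sigmaP S X le_mn; have [y0 ys _] := sigmaP S Y le_mn.
have xr := near _ Xr; have yr := near _ Yr.
rewrite (spectral_operator_svd le_mn g_sym (rD _ xr) UU VV XE).
rewrite (spectral_operator_svd le_mn g_sym (rD _ yr) UU' VV' YE).
have N0 := l1norm_ge0 S (X - Y).
have xy : l1norm RealField (sigma S X - sigma S Y) <= k * `[X - Y].
  by rewrite /k -mulrA; exact: sigma_lipschitz.
have XYE : X - Y = svd_diff S U U' V V' (sigma S X) (sigma S Y).
  by congr (_ - _); [exact: XE | exact: YE].
move: (sigma S X) (sigma S Y) x0 xs y0 ys xr yr xy XE YE XYE => x y x0 xs y0 ys xr yr xy _ _ XYE.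
have [gx1 gx2] := rS _ xr; have [gy1 gy2] := rS _ yr.
have e0 : 0 <= 2 * c * k * `[X - Y] by rewrite !mulr_ge0.
have := @svd_diff_lipschitz _ _ S m n le_mn U U' V V' UU UU' VV VV' x y (g x) (g y) c
  (2 * c * k * `[X - Y]) c0 e0.
rewrite -XYE -/(svd_diff S U U' V V' (g x) (g y)) => h.
apply: le_trans (h _ _ _) _; last lra.
- move=> i j.
  have h1 : `|g x j 0 - g y j 0| <= c * (k * `[X - Y]).
    have := col_entry_le (g x - g y) j; rewrite !mxE => /le_trans; apply.
    by apply: le_trans (rL _ _ xr yr) _; rewrite ler_wpM2l.
  have h2 := gy1 i j.
  have h3 : c * `|y j 0 - y i 0| <= c * (k * `[X - Y] + `|x j 0 - y i 0|).
    rewrite ler_wpM2l // -[y j 0 - y i 0](subrKA (x j 0)).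
    apply: le_trans (ler_normD _ _) _; rewrite lerD2r distrC.
    by have := col_entry_le (x - y) j; rewrite !mxE => /le_trans; apply.
  rewrite -[g x j 0 - g y i 0](subrKA (g y j 0)).
  apply: le_trans (ler_normD _ _) _; lra.
- move=> i j; apply: le_trans (ler_normD _ _) _.
  rewrite [`|x j 0 + _|]ger0_norm ?addr_ge0 //.
  have := gx2 j; have := gy2 i; rewrite (ger0_norm (x0 j)) (ger0_norm (y0 i)) => h1 h2; lra.
- exact: gy2.
Qed.

End SpectralLipschitz.

(** * Unitary matrices agreeing with 1 + A to second order *)

Section Cayley.
Variables (R : realType) (K : numFieldType) (S : real_or_complex R K).
Local Notation "A ^*h" := (adjoint S A) (at level 8, format "A ^*h").
Local Notation "`[ A ]" := (l1norm S A) (at level 0, A at level 99).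

Lemma unitary_l1norm n (P : 'M[K]_n) : unitary S P -> `[P] <= (n * n)%:R.
Proof.
move=> PP; rewrite -[leRHS]mulr1; apply: l1norm_le => i j; exact: unitary_entry.
Qed.

(* The Cayley transform (1 - A/2)^-1 (1 + A/2) agrees with 1 + A to second order. *)
Lemma cayley n (A : 'M[K]_n) : A^*h = - A ->
  exists2 P, unitary S P & `[P - 1%:M - A] <= (n * n)%:R * `[A] ^+ 2.
Proof.
move=> AA; pose a : K := of_real S (2^-1).
have ca : conj_scalar S a = a by exact: conj_of_real.
have aa : a + a = 1 by rewrite /a -rmorphD -[RHS](rmorph1 (of_real S)); congr of_real; lra.
pose B := 1%:M - a *: A; pose C := 1%:M + a *: A.
have BC : B^*h = C by rewrite /B raddfB /= adjoint1 adjointZ AA ca scalerN opprK.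
have CB : C^*h = B by rewrite -BC adjointK.
have comm : C *m B = B *m C.
  have -> : C = 1%:M + 1%:M - B by rewrite /B /C opprB addrACA subrr addr0.
  by move: B {BC CB} => B; rewrite mulmxBl mulmxBr mulmxDl mulmxDr mul1mx mulmx1.
have Bunit : B \in unitmx.
  rewrite unitmxE unitfE; apply/det0P => -[v v0 vB].
  have vE : v *m v^*h = a *: (v *m A *m v^*h).
    rewrite scalemxAl scalemxAr; congr (_ *m _); apply/eqP.
    by rewrite -subr_eq0 -{1}[v]mulmx1 -mulmxBr vB.
  have : (v *m v^*h)^*h = - (v *m v^*h).
    by rewrite {1}vE adjointZ ca !adjointM adjointK AA mulmxA mulmxN mulNmx scalerN -vE.
  rewrite mulmx_adjoint_row adjoint_scalar conj_of_real => /matrixP/(_ 0 0).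
  rewrite !mxE eqxx mulr1n -rmorphN => /of_real_inj sq.
  have /sqnorm_eq0 vv : sqnorm S v = 0 by lra.
  by rewrite vv eqxx in v0.
have IB : invmx B *m B = 1%:M by exact: mulVmx.
have CI : C *m (invmx B)^*h = 1%:M by rewrite -BC -adjointM IB adjoint1.
pose P := invmx B *m C.
have PP : unitary S P.
  rewrite /unitary /P adjointM CB !mulmxA -(mulmxA _ C B) comm mulmxA IB mul1mx.
  exact: CI.
exists P => //.
have -> : P - 1%:M - A = invmx B *m (a *: (A *m A)).
  have -> : P - 1%:M - A = invmx B *m (C - B - B *m A).
    by rewrite /P; move: B C IB {BC CB comm Bunit CI P PP} => B C IB; rewrite !mulmxBr IB mulmxA IB mul1mx.
  congr (_ *m _); rewrite /B /C mulmxBl mul1mx -scalemxAl opprB [_ + (_ - 1%:M)]addrA.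
  rewrite [1%:M + _ + _]addrAC -addrA [1%:M + _]addrC addrK.
  by rewrite -scalerDl aa scale1r opprB addrC subrK.
(* Since P is unitary, this bounds the inverse of 1 - A/2 for every skew-Hermitian A, however
   large. *)
have I2 : invmx B = a *: (P + 1%:M).
  rewrite /P -IB -mulmxDr.
  have -> : C + B = 1%:M + 1%:M by rewrite /B /C addrACA subrr addr0.
  by rewrite mulmxDr mulmx1 -mulr2n -scaler_nat scalerA mulr_natr mulr2n aa scale1r.
apply: le_trans (ler_l1normM _ _ _) _.
have a1 : modulus S a <= 1.
  by rewrite modulus_of_real ger0_norm ?invr_ge0 // invf_le1 // ler1n.
apply: ler_pM; rewrite ?l1norm_ge0 //.
  rewrite I2 l1normZ modulus_of_real ger0_norm ?invr_ge0 //.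
  have := ler_l1normD S P 1%:M; have := unitary_l1norm PP.
  have := unitary_l1norm (unitary1 S n); lra.
rewrite l1normZ expr2; apply: le_trans (ler_l1normM _ _ _).
by rewrite ler_piMl ?l1norm_ge0.
Qed.

End Cayley.

(** * Decomposition of a perturbation *)

Section SylvesterCoefficients.
Variable (R : realType).
Implicit Types a b : R.

(* For a <> b, the pair A_ij = cL a b * h - cL b a * h', B_ij = cR a b * h -
   cR b a * h' solves  h = A_ij b - a B_ij  together with its conjugate transpose
   h' = b B_ij - a A_ij; for a = b <> 0 it removes the skew part of h. *)
Definition coefL a b : R := if a == b then (2 * a)^-1 else b / (b ^+ 2 - a ^+ 2).
Definition coefR a b : R := if a == b then 0 else a / (b ^+ 2 - a ^+ 2).

(** Coefficients of h and h' in Delta_ij = h - A_ij b + a B_ij. They are 0, 0 for a <> b, and 1/2,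
    1/2 for a = b <> 0. For a = b = 0 they are 1, 0: the inverse of 0 is 0, and h is kept
    entirely. *)
Definition residual1 a b : R := 1 - coefL a b * b + a * coefR a b.
Definition residual2 a b : R := coefL b a * b - a * coefR b a.

Let sqr_neq a b : 0 <= a -> 0 <= b -> a != b -> b ^+ 2 - a ^+ 2 != 0.
Proof. by move=> a0 b0; rewrite subr_eq0 eqrXn2 // eq_sym. Qed.

Lemma residual1E a b : 0 <= a -> 0 <= b ->
  residual1 a b = if a == b then if a == 0 then 1 else 2^-1 else 0.
Proof.
move=> a0 b0; rewrite /residual1 /coefL /coefR.
have [<-|ab] := eqVneq a b.
  have [->|az] := eqVneq a 0; first by rewrite !mulr0 subr0 addr0.
  by field.
by have := sqr_neq a0 b0 ab => ?; field.
Qed.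

Lemma residual2E a b : 0 <= a -> 0 <= b ->
  residual2 a b = if a == b then if a == 0 then 0 else 2^-1 else 0.
Proof.
move=> a0 b0; rewrite /residual2 /coefL /coefR [b == a]eq_sym.
have [<-|ab] := eqVneq a b.
  have [->|az] := eqVneq a 0; first by rewrite mulr0 mul0r subr0.
  by field.
by rewrite mulrAC mulrA subrr.
Qed.

(** Entrywise form of X^* Delta = Delta^* X for diagonal X; [residual_right] plays this part for X
    Delta^* = Delta X^*. *)
Lemma residual_left a b : 0 <= a -> 0 <= b -> a * residual1 a b = b * residual2 b a.
Proof.
move=> a0 b0; rewrite residual1E // residual2E // [b == a]eq_sym.
have [<-|ab] := eqVneq a b; last by rewrite !mulr0.
by have [->|//] := eqVneq a 0; rewrite !mul0r.
Qed.

Lemma residual_right a b : 0 <= a -> 0 <= b -> residual1 a b * b = a * residual2 b a.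
Proof.
move=> a0 b0; rewrite residual1E // residual2E // [b == a]eq_sym.
have [<-|ab] := eqVneq a b; last by rewrite mul0r mulr0.
by have [->|_] := eqVneq a 0; rewrite ?mul0r ?mulr0 // mulrC.
Qed.

End SylvesterCoefficients.

Section Decomposition.
Variables (R : realType) (K : numFieldType) (S : real_or_complex R K).
Local Notation "A ^*h" := (adjoint S A) (at level 8, format "A ^*h").
Local Notation "`[ A ]" := (l1norm S A) (at level 0, A at level 99).

Lemma skew_of_entries n (A : 'M[K]_n) :
  (forall i j, conj_scalar S (A j i) = - A i j) -> A^*h = - A.
Proof. by move=> AE; apply/matrixP => i j; rewrite adjointE [RHS]mxE. Qed.

Lemma skew_of_coef n (c : 'I_n -> 'I_n -> R) (H : 'M[K]_n) (A : 'M[K]_n) :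
  (forall i j, A i j = of_real S (c i j) * H i j
                       - of_real S (c j i) * conj_scalar S (H j i)) ->
  forall i j, conj_scalar S (A j i) = - A i j.
Proof.
move=> AE i j; rewrite !AE.
by rewrite rmorphB !rmorphM /= !conj_of_real conj_scalarK opprB.
Qed.

Lemma modulus_of_coef n (c : 'I_n -> 'I_n -> R) (H : 'M[K]_n) (A : 'M[K]_n) (h : R) :
  (forall i j, A i j = of_real S (c i j) * H i j
                       - of_real S (c j i) * conj_scalar S (H j i)) ->
  (forall i j, modulus S (H i j) <= h) ->
  forall i j, modulus S (A i j) <= 2 * (\sum_i \sum_j `|c i j|) * h.
Proof.
move=> AE Hh i j; rewrite AE.
have cb k l : `|c k l| <= \sum_i \sum_j `|c i j|.
  rewrite (bigD1 k) //= (bigD1 l) //= -addrA lerDl addr_ge0 //.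
    exact: sumr_ge0.
  by do 2![apply: sumr_ge0 => ? _].
apply: le_trans (ler_modulusD _ _ _) _.
rewrite modulusN !modulusM modulus_conj !modulus_of_real -mulrA mulr_natl mulr2n.
by apply: lerD; apply: ler_pM => //; rewrite modulus_ge0.
Qed.

Variables (m n : nat) (le_mn : (m <= n)%N).

(** Padding s and H with zeros to size n ([al], [H']) lets one entrywise formula serve for A and B,
    the extra columns being paired with the singular value 0; A is then cut back to size m. The
    bound k involves only the coefficients, hence only s. *)
Lemma sylvester_diagonal (s : 'cV[R]_m) : (forall i, 0 <= s i 0) ->
  exists2 k : R, 0 <= k & forall H : 'M[K]_(m, n),
  let X := diag_block S n s in
  exists (A : 'M[K]_m) (B : 'M[K]_n) (D : 'M[K]_(m, n)),
  [/\ A^*h = - A, B^*h = - B, H = A *m X - X *m B + D,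
    X *m D^*h = D *m X^*h /\ X^*h *m D = D^*h *m X &
    `[A] <= k * `[H] /\ `[B] <= k * `[H]].
Proof.
move=> s0; pose wd := widen_ord le_mn.
pose al (j : 'I_n) : R := if insub (j : nat) is Some i then s i 0 else 0.
have al_wd i : al (wd i) = s i 0 by rewrite /al /= valK.
have al0 j : 0 <= al j by rewrite /al; case: insubP.
pose cL (i j : 'I_n) := coefL (al i) (al j).
pose cR (i j : 'I_n) := coefR (al i) (al j).
pose k := (n * n)%:R * (2 * (\sum_i \sum_j `|cL i j| + \sum_i \sum_j `|cR i j|)).
have sum0 (c : 'I_n -> 'I_n -> R) : 0 <= \sum_i \sum_j `|c i j|.
  by do 2![apply: sumr_ge0 => ? _].
exists k; first by rewrite !mulr_ge0 // addr_ge0.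
move=> H X.
pose H' : 'M[K]_n := \matrix_(i, j) if insub (i : nat) is Some i' then H i' j else 0.
have H'_wd i j : H' (wd i) j = H i j by rewrite mxE /= valK.
pose A' : 'M[K]_n := \matrix_(i, j)
  (of_real S (cL i j) * H' i j - of_real S (cL j i) * conj_scalar S (H' j i)).
pose B : 'M[K]_n := \matrix_(i, j)
  (of_real S (cR i j) * H' i j - of_real S (cR j i) * conj_scalar S (H' j i)).
have A'E i j : A' i j = of_real S (cL i j) * H' i j
    - of_real S (cL j i) * conj_scalar S (H' j i) by rewrite mxE.
have BE i j : B i j = of_real S (cR i j) * H' i j
    - of_real S (cR j i) * conj_scalar S (H' j i) by rewrite mxE.
pose A : 'M[K]_m := \matrix_(i, j) A' (wd i) (wd j).
pose D' : 'M[K]_n := \matrix_(i, j)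
  (of_real S (residual1 (al i) (al j)) * H' i j +
   of_real S (residual2 (al i) (al j)) * conj_scalar S (H' j i)).
have D'E i j : D' i j = H' i j - A' i j * of_real S (al j) + of_real S (al i) * B i j.
  rewrite A'E BE mxE /residual1 /residual2 -/(cL i j) -/(cL j i) -/(cR i j) -/(cR j i).
  by rewrite !(rmorphB, rmorphD, rmorphM, rmorph1) /=; ring.
pose D : 'M[K]_(m, n) := \matrix_(i, j) D' (wd i) j.
have DE i j : D i j = D' (wd i) j by rewrite mxE.
have conjD i j : conj_scalar S (D' i j) =
    of_real S (residual1 (al i) (al j)) * conj_scalar S (H' i j) +
    of_real S (residual2 (al i) (al j)) * H' j i.
  by rewrite mxE rmorphD !rmorphM /= !conj_of_real conj_scalarK.
have left_comm i j : of_real S (al i) * D' i j = of_real S (al j) * conj_scalar S (D' j i).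
  rewrite conjD mxE !mulrDr !mulrA -!rmorphM /= (residual_left (al0 i) (al0 j)).
  by rewrite -(residual_left (al0 j) (al0 i)) addrC.
have right_comm i j : D' i j * of_real S (al j) = of_real S (al i) * conj_scalar S (D' j i).
  rewrite conjD mxE mulrDr mulrC mulrDr !mulrA -!rmorphM /=.
  rewrite ![al j * _]mulrC (residual_right (al0 i) (al0 j)).
  by rewrite [al i * residual1 _ _]mulrC (residual_right (al0 j) (al0 i)) mulrC addrC [al j * _]mulrC.
have AE i j : A i j = A' (wd i) (wd j) by rewrite mxE.
have AX i j : (A *m X) i j = A' (wd i) j * of_real S (al j).
  have [mj|jm] := leqP m j.
    rewrite mul_mx_diag_block_ge // /al insubF ?rmorph0 ?mulr0 //.
    by rewrite ltnNge mj.
  have -> : j = wd (Ordinal jm) by exact/val_inj.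
  by rewrite mul_mx_diag_block al_wd mxE.
exists A, B, D; split.
- by apply: skew_of_entries => i j; rewrite !AE; exact: skew_of_coef A'E _ _.
- exact: skew_of_entries (skew_of_coef BE).
- apply/matrixP => i j; rewrite [RHS]mxE [X in X + _]mxE AX [X in _ + X + _]mxE.
  rewrite (mul_diag_block_mx _ _ _ _ _ le_mn) DE D'E H'_wd al_wd; ring.
- have XD i j : (X *m D^*h) i j = of_real S (al (wd i)) * conj_scalar S (D' (wd j) (wd i)).
    by rewrite (mul_diag_block_mx _ _ _ _ _ le_mn) adjointE DE al_wd.
  have DX i j : (D^*h *m X) i j = conj_scalar S (D' j i) * of_real S (al j).
    have [mj|jm] := leqP m j.
      rewrite mul_mx_diag_block_ge // /al insubF ?rmorph0 ?mulr0 //.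
      by rewrite ltnNge mj.
    have -> : j = wd (Ordinal jm) by exact/val_inj.
    by rewrite mul_mx_diag_block al_wd adjointE DE.
  split; apply/matrixP => i j.
    have -> : D *m X^*h = (X *m D^*h)^*h by rewrite adjointM adjointK.
    rewrite adjointE !XD rmorphM /= conj_of_real conj_scalarK -right_comm.
    exact: mulrC.
  have -> : X^*h *m D = (D^*h *m X)^*h by rewrite adjointM adjointK.
  rewrite adjointE !DX rmorphM /= conj_of_real conj_scalarK mulrC left_comm.
  exact: mulrC.
have H'h i j : modulus S (H' i j) <= `[H].
  rewrite mxE; case: insubP => [i' _ _|_]; first exact: l1norm_entry.
  by rewrite modulus0 l1norm_ge0.
have N0 := l1norm_ge0 S H; have cL0 := sum0 cL; have cR0 := sum0 cR.
split.
  apply: (@le_trans _ _ ((m * m)%:R * (2 * (\sum_i \sum_j `|cL i j|) * `[H]))).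
    by apply: l1norm_le => i j; rewrite AE; exact: modulus_of_coef A'E H'h _ _.
  rewrite /k -!mulrA ler_pM // ?mulr_ge0 // ?ler_nat ?leq_mul //.
  by rewrite ler_wpM2l // ler_wpM2r // lerDl.
apply: (@le_trans _ _ ((n * n)%:R * (2 * (\sum_i \sum_j `|cR i j|) * `[H]))).
  by apply: l1norm_le => i j; exact: modulus_of_coef BE H'h _ _.
by rewrite /k -!mulrA !ler_wpM2l // ler_wpM2r // lerDr.
Qed.

(** The diagonal case is conjugated by one fixed decomposition of X, and Delta is then diagonalized
    together with X. W and Z depend on H while k depends on X alone. The size of d follows from
    Delta = H - A X + X B by reading the diagonal of W^* Delta Z. *)
Lemma common_svd_decomposition (X : 'M[K]_(m, n)) :
  exists2 k : R, 0 <= k & forall H : 'M[K]_(m, n),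
  exists (A : 'M[K]_m) (B : 'M[K]_n) (W : 'M[K]_m) (Z : 'M[K]_n) (d : 'cV[R]_m),
  [/\ A^*h = - A, B^*h = - B, unitary S W /\ unitary S Z,
    X = W *m diag_block S n (sigma S X) *m Z^*h /\
    H = A *m X - X *m B + W *m diag_block S n d *m Z^*h &
    [/\ `[A] <= k * `[H], `[B] <= k * `[H] & l1norm RealField d <= k * `[H]]].
Proof.
have [U [V [UU VV XE]]] := svd_exists S le_mn X.
have [s0 _ _] := sigmaP S X le_mn.
have [k k0 kP] := sylvester_diagonal s0.
pose kA := (m * m)%:R * (k * (m * n)%:R); pose kB := (n * n)%:R * (k * (m * n)%:R).
have kA0 : 0 <= kA by rewrite !mulr_ge0.
have kB0 : 0 <= kB by rewrite !mulr_ge0.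
have X0 := l1norm_ge0 S X.
pose kd := m%:R * (1 + kA * `[X] + `[X] * kB).
have kd0 : 0 <= kd by rewrite mulr_ge0 // !addr_ge0 // mulr_ge0.
exists (kA + kB + kd) => [|H]; first by rewrite !addr_ge0.
have N0 := l1norm_ge0 S H.
have [A0 [B0 [D0 [AA BB HE [XD DX] [A0H B0H]]]]] := kP (U^*h *m H *m V).
set X1 := diag_block S n (sigma S X) in XE HE XD DX.
pose A := U *m A0 *m U^*h; pose B := V *m B0 *m V^*h; pose D := U *m D0 *m V^*h.
have UHV : `[U^*h *m H *m V] <= (m * n)%:R * `[H].
  by apply: unitary_mul_l1norm => //; exact: unitary_adjoint.
have AH : `[A] <= kA * `[H].
  apply: le_trans (unitary_mul_l1norm _ UU (unitary_adjoint UU)) _.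
  rewrite /kA -!mulrA ler_wpM2l //; apply: le_trans A0H _; exact: ler_wpM2l.
have BH : `[B] <= kB * `[H].
  apply: le_trans (unitary_mul_l1norm _ VV (unitary_adjoint VV)) _.
  rewrite /kB -!mulrA ler_wpM2l //; apply: le_trans B0H _; exact: ler_wpM2l.
have AX : A *m X = U *m (A0 *m X1) *m V^*h.
  by rewrite /A XE !mulmxA -(mulmxA _ U^*h U) (unitaryC UU) mulmx1.
have XB : X *m B = U *m (X1 *m B0) *m V^*h.
  by rewrite /B XE !mulmxA -(mulmxA _ V^*h V) (unitaryC VV) mulmx1.
have HD : H = A *m X - X *m B + D.
  rewrite AX XB /D -mulmxBl -mulmxBr -mulmxDl -mulmxDr -HE.
  by rewrite -{1}(unitary_mulK H UU (unitary_adjoint VV)) adjointK.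
have DH : `[D] <= (1 + kA * `[X] + `[X] * kB) * `[H].
  have -> : D = H - (A *m X - X *m B) by rewrite {1}HD addrC addKr.
  apply: le_trans (ler_l1normB _ _ _) _.
  have := ler_l1normB S (A *m X) (X *m B).
  have := ler_l1normM S A X; have := ler_l1normM S X B.
  have := ler_wpM2r X0 AH; have := ler_wpM2l X0 BH; lra.
have [||W [Z [d [WW ZZ XW DW]]]] := @simultaneous_svd _ _ S m n X D le_mn.
- rewrite /D {1 2}XE !adjointM !adjointK !mulmxA.
  rewrite -!(mulmxA _ V^*h V) !(unitaryC VV) !mulmx1 -!(mulmxA U) XD.
  by rewrite !mulmxA.
- rewrite /D {1 2}XE !adjointM !adjointK !mulmxA.
  rewrite -!(mulmxA _ U^*h U) !(unitaryC UU) !mulmx1 -!(mulmxA V) DX.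
  by rewrite !mulmxA.
exists A, B, W, Z, d; split=> //.
- by rewrite /A !adjointM adjointK AA mulNmx mulmxN mulmxA.
- by rewrite /B !adjointM adjointK BB mulNmx mulmxN mulmxA.
- by split=> //; rewrite -DW.
split.
- by apply: le_trans AH _; rewrite ler_wpM2r // -addrA lerDl addr_ge0.
- by apply: le_trans BH _; rewrite ler_wpM2r // addrAC lerDr addr_ge0.
apply: (@le_trans _ _ (kd * `[H])); last by rewrite ler_wpM2r // lerDr addr_ge0.
rewrite /kd -mulrA; apply: le_trans (ler_wpM2l _ DH) => //.
apply: col_l1norm_le => i; rewrite -(modulus_of_real S).
have -> : of_real S (d i 0) = (W^*h *m D *m Z) i (widen_ord le_mn i).
  rewrite DW !mulmxA (unitaryC WW) mul1mx -mulmxA (unitaryC ZZ) mulmx1.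
  by rewrite diag_blockE eqxx.
by apply: unitary_mul_entry => ? ?; apply: unitary_entry => //; exact: unitary_adjoint.
Qed.


End Decomposition.

(** * Second-order expansion and the theorem *)

Section Expansion.
Variables (R : realType) (K : numFieldType) (S : real_or_complex R K).
Local Notation "A ^*h" := (adjoint S A) (at level 8, format "A ^*h").
Local Notation "`[ A ]" := (l1norm S A) (at level 0, A at level 99).

(** Used for Y0 = X and for Y0 = G X. The five terms of the expansion are each a product of two
    small factors or contain a second-order one; four of them give 2 + 1 + 2 + 1 = 6, and the cross
    term gives 8 k^3. *)
Lemma conj_second_order m n (P A : 'M[K]_m) (Q B : 'M[K]_n) (Y Y0 : 'M[K]_(m, n))
    (k h : R) : 0 <= k -> 0 <= h -> h <= 1 ->
  `[A] <= k * h -> `[B] <= k * h -> `[Y - Y0] <= k * h -> `[Y0] <= k ->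
  `[P - 1%:M - A] <= k * h ^+ 2 -> `[Q - 1%:M + B] <= k * h ^+ 2 ->
  `[P *m Y *m Q - Y - (A *m Y0 - Y0 *m B)] <= (6 * k ^+ 2 + 8 * k ^+ 3) * h ^+ 2.
Proof.
move=> k0 h0 h1 Ah Bh Yh Y0k Ph Qh.
have -> : P *m Y *m Q - Y - (A *m Y0 - Y0 *m B) =
    (P - 1%:M - A) *m Y + A *m (Y - Y0) + Y *m (Q - 1%:M + B) - (Y - Y0) *m B
    + (P - 1%:M) *m Y *m (Q - 1%:M).
  rewrite !(mulmxDr, mulmxDl, mulmxN, mulNmx) !mul1mx !mulmx1.
  move: (P *m Y *m Q) (P *m Y) (Y *m Q) (A *m Y) (A *m Y0) (Y *m B) (Y0 *m B).
  by move=> *; apply/matrixP => i j; rewrite !mxE; ring.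
have hh : h ^+ 2 <= h by rewrite expr2 ler_piMr.
have kh : k * h <= k by rewrite ler_piMr.
have khh : k * h ^+ 2 <= k * h by rewrite ler_wpM2l.
have kh0 : 0 <= k * h by rewrite mulr_ge0.
have Yk : `[Y] <= 2 * k.
  by have := ler_l1normD S (Y - Y0) Y0; rewrite subrK; lra.
have P1 : `[P - 1%:M] <= 2 * (k * h).
  by have := ler_l1normD S (P - 1%:M - A) A; rewrite subrK; lra.
have Q1 : `[Q - 1%:M] <= 2 * (k * h).
  by have := ler_l1normB S (Q - 1%:M + B) B; rewrite addrK; lra.
have N := l1norm_ge0 S.
have t1 : `[(P - 1%:M - A) *m Y] <= (k * h ^+ 2) * (2 * k).
  by apply: le_trans (ler_l1normM _ _ _) _; exact: ler_pM.
have t2 : `[A *m (Y - Y0)] <= (k * h) * (k * h).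
  by apply: le_trans (ler_l1normM _ _ _) _; exact: ler_pM.
have t3 : `[Y *m (Q - 1%:M + B)] <= (2 * k) * (k * h ^+ 2).
  by apply: le_trans (ler_l1normM _ _ _) _; exact: ler_pM.
have t4 : `[(Y - Y0) *m B] <= (k * h) * (k * h).
  by apply: le_trans (ler_l1normM _ _ _) _; exact: ler_pM.
have t5 : `[(P - 1%:M) *m Y *m (Q - 1%:M)] <= 2 * (k * h) * (2 * k) * (2 * (k * h)).
  apply: le_trans (ler_l1normM _ _ _) _; apply: ler_pM => //.
  by apply: le_trans (ler_l1normM _ _ _) _; exact: ler_pM.
apply: le_trans (ler_l1normD _ _ _) _.
apply: le_trans (lerD (ler_l1normB _ _ _) (lexx _)) _.
apply: le_trans (lerD (lerD (ler_l1normD _ _ _) (lexx _)) (lexx _)) _.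
apply: le_trans (lerD (lerD (lerD (ler_l1normD _ _ _) (lexx _)) (lexx _)) (lexx _)) _.
lra.
Qed.

Lemma diag_blockB m n (x y : 'cV[R]_m) :
  diag_block S n (x - y) = diag_block S n x - diag_block S n y.
Proof.
apply/matrixP => i j; rewrite [RHS]mxE [X in _ = _ + X]mxE !diag_blockE.
by case: eqP => _; rewrite ?subr0 // !mxE rmorphB.
Qed.

Lemma diag_blockD m n (x y : 'cV[R]_m) :
  diag_block S n (x + y) = diag_block S n x + diag_block S n y.
Proof.
apply/matrixP => i j; rewrite [RHS]mxE !diag_blockE.
by case: eqP => _; rewrite ?addr0 // !mxE rmorphD.
Qed.

Lemma diag_blockZ m n (t : R) (x : 'cV[R]_m) :
  diag_block S n (t *: x) = of_real S t *: diag_block S n x.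
Proof.
apply/matrixP => i j; rewrite [RHS]mxE !diag_blockE.
by case: eqP => _; rewrite ?mulr0 // !mxE rmorphM.
Qed.

Lemma l1norm_svd_le m n (W : 'M[K]_m) (Z : 'M[K]_n) (x : 'cV[R]_m) :
  unitary S W -> unitary S Z ->
  `[W *m diag_block S n x *m Z^*h] <= ((m * n) ^ 2)%:R * l1norm RealField x.
Proof.
move=> WW ZZ; apply: le_trans (unitary_mul_l1norm _ WW (unitary_adjoint ZZ)) _.
rewrite natrX expr2 -mulrA ler_wpM2l //; apply: l1norm_le => i j.
rewrite diag_blockE; case: eqP => _; last by rewrite modulus0 l1norm_ge0.
by rewrite modulus_of_real; exact: col_entry_le.
Qed.

Lemma svd_mulB m n (W : 'M[K]_m) (Z : 'M[K]_n) (x y : 'cV[R]_m) :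
  W *m diag_block S n x *m Z^*h - W *m diag_block S n y *m Z^*h =
  W *m diag_block S n (x - y) *m Z^*h.
Proof. by rewrite diag_blockB mulmxBr mulmxBl. Qed.

Variables (m n : nat) (le_mn : (m <= n)%N).
Variables (D : set 'cV[R]_m) (g : 'cV[R]_m -> 'cV[R]_m) (X : 'M[K]_(m, n)).
Local Notation s := (sigma S X).
Local Notation G := (spectral_operator S g).
Hypotheses (D_open : open D) (Ds : D s) (g_sym : absolutely_symmetric D g).
Hypothesis g_lip : locally_lipschitz_near RealField g s.

(* With Delta = W [e] Z^*, the point X + H differs from the unitarily rotated
   point P (X + Delta) Q^* by O(h^2), and the spectral operator is computed
   exactly at the latter. *)
Lemma spectral_operator_expansion (k : R) : 0 <= k ->
  exists r C : R, [/\ 0 < r, 0 <= C &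
  forall (h : R) (H : 'M[K]_(m, n)) A B W Z (e : 'cV[R]_m), 0 <= h -> h < r ->
    A^*h = - A -> B^*h = - B -> unitary S W -> unitary S Z ->
    X = W *m diag_block S n s *m Z^*h ->
    H = A *m X - X *m B + W *m diag_block S n e *m Z^*h ->
    `[A] <= k * h -> `[B] <= k * h -> l1norm RealField e <= k * h ->
    `[G (X + H) - G X - (A *m G X - G X *m B)
      - W *m diag_block S n (g (s + e) - g s) *m Z^*h] <= C * h ^+ 2].
Proof.
move=> k0.
have [rg [cg [rg0 cg0 rgD rgL]]] := lipschitz_l1norm D_open Ds g_lip.
have [rG [cG [rG0 cG0 rGL]]] := spectral_operator_lipschitz le_mn D_open Ds g_sym g_lip.
pose mn2 : R := ((m * n) ^ 2)%:R; have mn20 : 0 <= mn2 by [].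
have NX := l1norm_ge0 S X; have NG := l1norm_ge0 S (G X).
(* One constant for both uses of [conj_second_order]: k for A and B, the next two summands for the
   Cayley errors, the norms for Y0, and the last two for the displacements of X and of G X. *)
pose k1 := k + (m * m)%:R * k ^+ 2 + (n * n)%:R * k ^+ 2 + `[X] + `[G X] + mn2 * k
  + mn2 * (cg * k).
have mmk : 0 <= (m * m)%:R * k ^+ 2 by rewrite mulr_ge0 // exprn_ge0.
have nnk : 0 <= (n * n)%:R * k ^+ 2 by rewrite mulr_ge0 // exprn_ge0.
have mnk : 0 <= mn2 * k by rewrite mulr_ge0.
have mnck : 0 <= mn2 * (cg * k) by rewrite !mulr_ge0.
have k10 : 0 <= k1 by rewrite /k1; lra.
pose c1 := 6 * k1 ^+ 2 + 8 * k1 ^+ 3.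
have c10 : 0 <= c1 by rewrite addr_ge0 // mulr_ge0 // exprn_ge0.
pose kH := k * `[X] + `[X] * k + mn2 * k.
have kX0 : 0 <= k * `[X] by rewrite mulr_ge0.
have kH0 : 0 <= kH by rewrite /kH; lra.
pose km := m%:R * (2 * m%:R) : R; have km0 : 0 <= km by rewrite !mulr_ge0.
(* With M h below both radii, X + H and X' stay where G is Lipschitz, s + e stays where g is, and
   the factor km + 1 keeps the singular values of X' near s as well. *)
pose M := (c1 + kH + k + 1) * (km + 1).
have M0 : 0 < M by rewrite mulr_gt0 //; lra.
pose r := Num.min 1 (Num.min rg rG / M).
exists r, (cG * c1 + c1); split.
- by rewrite lt_min ltr01 divr_gt0 // lt_min rg0.
- by rewrite addr_ge0 // mulr_ge0.
move=> h H A B W Z e h0; rewrite lt_min => /andP[/ltW h1 hM] AA BB WW ZZ XE HE Ah Bh eh.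
have {hM} : M * h < Num.min rg rG by rewrite mulrC -ltr_pdivlMr.
rewrite lt_min => /andP[hg hG].
have [P PP Ph] := cayley AA; have [Q QQ Qh] := cayley BB.
have sqk (a : R) : 0 <= a -> a <= k * h -> a ^+ 2 <= k ^+ 2 * h ^+ 2.
  by move=> a0 ak; rewrite -exprMn ler_pXn2r // nnegrE mulr_ge0.
have h20 : 0 <= h ^+ 2 by rewrite exprn_ge0.
have {}Ph : `[P - 1%:M - A] <= k1 * h ^+ 2.
  apply: le_trans Ph _; apply: le_trans (ler_wpM2l _ (sqk _ (l1norm_ge0 _ _) Ah)) _ => //.
  by rewrite mulrA ler_wpM2r // /k1; lra.
have {}Qh : `[Q^*h - 1%:M + B] <= k1 * h ^+ 2.
  have -> : Q^*h - 1%:M + B = (Q - 1%:M - B)^*h.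
    by rewrite !(raddfB (@adjoint _ _ S n n)) /= adjoint1 BB opprK.
  rewrite l1norm_adjoint; apply: le_trans Qh _.
  apply: le_trans (ler_wpM2l _ (sqk _ (l1norm_ge0 _ _) Bh)) _ => //.
  by rewrite mulrA ler_wpM2r // /k1; lra.
have kk1 : k * h <= k1 * h by rewrite ler_wpM2r // /k1; lra.
pose X2 := W *m diag_block S n (s + e) *m Z^*h.
have X2X : X2 - X = W *m diag_block S n e *m Z^*h.
  by rewrite {1}XE /X2 svd_mulB addrC addKr.
have De : `[X2 - X] <= mn2 * (k * h).
  rewrite X2X; apply: le_trans (l1norm_svd_le _ WW ZZ) _; exact: ler_wpM2l.
pose X' := P *m X2 *m Q^*h.
have X'H : `[X' - (X + H)] <= c1 * h ^+ 2.
  have -> : X' - (X + H) = P *m X2 *m Q^*h - X2 - (A *m X - X *m B).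
    by rewrite HE -X2X addrCA [X + (X2 - X)]addrC subrK opprD addrA addrAC.
  apply: conj_second_order => //; try exact: le_trans kk1.
  - apply: le_trans De _; rewrite mulrA ler_wpM2r // /k1; lra.
  - rewrite /k1; lra.
have Hh : `[H] <= kH * h.
  rewrite HE -X2X; apply: le_trans (ler_l1normD _ _ _) _.
  have := ler_l1normB S (A *m X) (X *m B).
  have := ler_l1normM S A X; have := ler_l1normM S X B.
  have := ler_wpM2r NX Ah; have := ler_wpM2l NX Bh; rewrite /kH; lra.
have hh : h ^+ 2 <= h by rewrite expr2 ler_piMr.
have ch : c1 * h ^+ 2 <= c1 * h by rewrite ler_wpM2l.
have kmh : 0 <= km * ((c1 + kH + k + 1) * h).
  by rewrite !mulr_ge0 //; lra.
have kh0 : 0 <= k * h by rewrite mulr_ge0.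
have ch0 : 0 <= c1 * h by rewrite mulr_ge0.
have kHh0 : 0 <= kH * h by rewrite mulr_ge0.
have X'X : `[X' - X] <= c1 * h + kH * h.
  apply: le_trans (l1norm_triangle S (X + H) _ _) _.
  by rewrite addrAC subrr add0r; lra.
have X'r : `[X' - X] < rG by apply: le_lt_trans hG; rewrite /M; lra.
have Hr : `[X + H - X] < rG.
  by rewrite addrAC subrr add0r; apply: le_lt_trans hG; rewrite /M; lra.
(* [spectral_operator_svd] asks for the sorted singular values of X' to lie in D, whereas X' is
   known through s + e. *)
have DX' : D (sigma S X').
  apply: rgD; apply: le_lt_trans (sigma_lipschitz S le_mn _ _) _.
  apply: le_lt_trans hg; rewrite mulrA -/km; apply: le_trans (ler_wpM2l km0 X'X) _.
  have : 0 <= km * (k * h + h) by rewrite mulr_ge0 //; lra.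
  by rewrite /M; lra.
have er : l1norm RealField (s + e - s) < rg.
  by rewrite addrAC subrr add0r; apply: le_lt_trans hg; rewrite /M; lra.
pose Y := W *m diag_block S n (g (s + e)) *m Z^*h.
have GX : G X = W *m diag_block S n (g s) *m Z^*h.
  exact: (spectral_operator_svd le_mn g_sym Ds).
have GX' : G X' = P *m Y *m Q^*h.
  rewrite (@spectral_operator_svd _ _ S m n le_mn D g g_sym X' (P *m W) (Q *m Z) (s + e)) //.
  - by rewrite adjointM /Y !mulmxA.
  - exact: unitaryM.
  - exact: unitaryM.
  - by rewrite adjointM /X' /X2 !mulmxA.
have YG : Y - G X = W *m diag_block S n (g (s + e) - g s) *m Z^*h.
  by rewrite GX svd_mulB.
have Yh : `[Y - G X] <= k1 * h.
  rewrite YG; apply: le_trans (l1norm_svd_le _ WW ZZ) _.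
  have : l1norm RealField (g (s + e) - g s) <= cg * (k * h).
    apply: le_trans (rgL _ _ er _) _; first by rewrite subrr l1norm0.
    by rewrite addrAC subrr add0r ler_wpM2l.
  move=> /(ler_wpM2l mn20) hl; apply: le_trans hl _; rewrite !mulrA ler_wpM2r // /k1; lra.
have main : `[P *m Y *m Q^*h - Y - (A *m G X - G X *m B)] <= c1 * h ^+ 2.
  apply: conj_second_order => //; try exact: le_trans kk1.
  by rewrite /k1; lra.
rewrite -YG.
(* The first bracket is second order by Lipschitz continuity of G, the second by
   [conj_second_order]. *)
have -> : G (X + H) - G X - (A *m G X - G X *m B) - (Y - G X) =
    (G (X + H) - G X') + (P *m Y *m Q^*h - Y - (A *m G X - G X *m B)).
  rewrite GX'; move: (G (X + H)) (A *m G X - G X *m B) (P *m Y *m Q^*h) => u b c.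
  by rewrite opprB [u - _ - b]addrAC subrKA -[c - Y - b]addrA subrKA addrA addrAC.
apply: le_trans (ler_l1normD _ _ _) _; rewrite mulrDl; apply: lerD => //.
apply: le_trans (rGL _ _ Hr X'r) _; rewrite -mulrA ler_wpM2l // l1normBC; exact: X'H.
Qed.

End Expansion.

(** * The two implications *)

Section Main.
Variables (R : realType) (K : numFieldType) (S : real_or_complex R K).
Variables (m n : nat) (le_mn : (m <= n)%N).
Local Notation "A ^*h" := (adjoint S A) (at level 8, format "A ^*h").
Local Notation "`[ A ]" := (l1norm S A) (at level 0, A at level 99).

Variables (D : set 'cV[R]_m) (g : 'cV[R]_m -> 'cV[R]_m) (X : 'M[K]_(m, n)).
Local Notation s := (sigma S X).
Variables (N : set 'M[K]_(m, n)) (G : 'M[K]_(m, n) -> 'M[K]_(m, n)) (rho : R).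
Hypotheses (D_open : open D) (N_open : open N) (NX : N X).
Hypothesis (sigma_N : [set sigma S Y | Y in N] `<=` D).
Hypothesis (g_sym : absolutely_symmetric D g).
Hypothesis (G_def : forall Y, N Y -> G Y = spectral_operator S g Y).
Hypotheses (rho_gt0 : 0 < rho) (rho_le1 : rho <= 1).

Lemma spectral_operator_B_differentiable :
  locally_lipschitz_near RealField g s -> B_differentiable RealField g rho s ->
  B_differentiable S G rho X.
Proof.
move=> g_lip /(B_differentiableP RealField _ _ rho_gt0)[Cg [rg [rg0 gdiff]]].
have Ds : D s by apply: sigma_N; exists X.
have [rN rN0 rNP] := (nbhs_l1norm S X N).1 (open_nbhs_nbhs (conj N_open NX)).
have [kd kd0 decomp] := common_svd_decomposition S le_mn X.
have rho1 : 0 <= 1 + rho by rewrite addr_ge0 // ltW.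
pose mn2 : R := ((m * n) ^ 2)%:R; have mn20 : 0 <= mn2 by [].
have [r1 [C1 [r10 C10 exp1]]] :=
  spectral_operator_expansion le_mn D_open Ds g_sym g_lip kd0.
pose r := Num.min (Num.min rN 1) (Num.min r1 (rg / (kd + 1))).
have kd1 : 0 < kd + 1 by lra.
apply/(B_differentiableP S _ _ rho_gt0).
exists (C1 + mn2 * (`|Cg| * kd `^ (1 + rho))), r; split.
  by rewrite !lt_min rN0 ltr01 r10 divr_gt0.
move=> H; have [A [B [W [Z [d [AA BB [WW ZZ] [XE HE] [AH BH dH]]]]]]] := decomp H.
have [T gT gTd] := gdiff d.
exists (A *m G X - G X *m B + W *m diag_block S n T *m Z^*h).
- have N0 := l1norm_ge0 S H.
  have kH0 : 0 <= kd * `[H] by rewrite mulr_ge0.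
  (* For the derivative H is fixed and t tends to 0. The expansion is used with h = t, and |H|
     enters its constant; the remainder instead needs h = |H| and a constant independent of H. *)
  have [r2 [C2 [r20 C20 exp2]]] :=
    spectral_operator_expansion le_mn D_open Ds g_sym g_lip kH0.
  move=> e e0; have e'0 : 0 < e / (2 * (mn2 + 1)).
    by rewrite divr_gt0 // mulr_gt0 //; lra.
  have [d1 d10 gT1] := gT _ e'0.
  (* The bounds serve, in order, the derivative of g, the expansion, membership of X + tH in N, and
     C2 t^2 <= e t / 2. *)
  pose dl := Num.min (Num.min d1 r2) (Num.min (rN / (`[H] + 1)) (e / (2 * (C2 + 1)))).
  exists dl; first by rewrite !lt_min d10 r20 !divr_gt0 //; lra.
  move=> t t0; rewrite !lt_min => /andP[/andP[td1 tr2] /andP[tN tC]].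
  have t0' := ltW t0.
  have tH : `[of_real S t *: H] < rN.
    rewrite l1normZ modulus_of_real gtr0_norm //.
    by rewrite ltr_pdivlMr in tN; lra.
  rewrite !G_def //; last by apply: rNP; rewrite addrAC subrr add0r.
  have ct : conj_scalar S (of_real S t) = of_real S t by exact: conj_of_real.
  have nt p q (M : 'M[K]_(p, q)) : `[of_real S t *: M] = t * `[M].
    by rewrite l1normZ modulus_of_real gtr0_norm.
  have bound : `[spectral_operator S g (X + of_real S t *: H) - spectral_operator S g X
      - (of_real S t *: A *m spectral_operator S g X
         - spectral_operator S g X *m (of_real S t *: B))
      - W *m diag_block S n (g (s + t *: d) - g s) *m Z^*h] <= C2 * t ^+ 2.
    apply: exp2 => //.
    - by rewrite adjointZ ct AA scalerN.
    - by rewrite adjointZ ct BB scalerN.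
    - by rewrite {1}HE -!scalemxAl -!scalemxAr diag_blockZ -scalemxAr -scalemxAl
        -scalerBr -scalerDr.
    - by rewrite nt mulrC ler_wpM2r.
    - by rewrite nt mulrC ler_wpM2r.
    - rewrite -[t *: d]/(of_real RealField t *: d) l1normZ.
      by rewrite (modulus_of_real RealField) gtr0_norm // mulrC ler_wpM2r.
  pose w := W *m diag_block S n (g (s + t *: d) - g s) *m Z^*h.
  have -> : of_real S t *: (A *m spectral_operator S g X - spectral_operator S g X *m B
        + W *m diag_block S n T *m Z^*h) =
      of_real S t *: A *m spectral_operator S g X
      - spectral_operator S g X *m (of_real S t *: B) + W *m diag_block S n (t *: T) *m Z^*h.
    by rewrite -scalemxAl -!scalemxAr diag_blockZ -scalemxAr -scalemxAl -scalerBr -scalerDr.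
  rewrite opprD addrA -(subrKA w); apply: le_trans (ler_l1normD _ _ _) _.
  have wT : `[w - W *m diag_block S n (t *: T) *m Z^*h] <= mn2 * (e / (2 * (mn2 + 1)) * t).
    rewrite /w svd_mulB; apply: le_trans (l1norm_svd_le _ WW ZZ) _.
    by rewrite ler_wpM2l //; exact: gT1.
  apply: le_trans (lerD bound wT) _.
  have e1 : mn2 * (e / (2 * (mn2 + 1)) * t) <= e / 2 * t.
    have -> : mn2 * (e / (2 * (mn2 + 1)) * t) = e / 2 * t * (mn2 / (mn2 + 1)).
      by field; lra.
    rewrite ler_piMr ?mulr_ge0 ?divr_ge0 ?(ltW e0) // ler_pdivrMr; lra.
  have e2 : C2 * t ^+ 2 <= e / 2 * t.
    rewrite expr2 mulrA ler_wpM2r //; move: tC; rewrite ltr_pdivlMr; last lra.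
    by lra.
  by apply: le_trans (lerD e2 e1) _; rewrite -mulrDl -splitr.
rewrite !lt_min => /andP[/andP[hN h1] /andP[hr1 hrg]].
have N0 := l1norm_ge0 S H.
rewrite !G_def //; last by apply: rNP; rewrite addrAC subrr add0r.
have bound := exp1 _ H A B W Z d N0 hr1 AA BB WW ZZ XE HE AH BH dH.
pose w := W *m diag_block S n (g (s + d) - g s) *m Z^*h.
rewrite opprD addrA -(subrKA w); apply: le_trans (ler_l1normD _ _ _) _.
have drg : l1norm RealField d < rg.
  by apply: le_lt_trans dH _; move: hrg; rewrite ltr_pdivlMr //; lra.
have wT : `[w - W *m diag_block S n T *m Z^*h] <=
    mn2 * (`|Cg| * (kd * `[H]) `^ (1 + rho)).
  rewrite /w svd_mulB; apply: le_trans (l1norm_svd_le _ WW ZZ) _.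
  rewrite ler_wpM2l //; apply: le_trans (gTd drg) _.
  apply: (@le_trans _ _ (`|Cg| * l1norm RealField d `^ (1 + rho))).
    by rewrite ler_wpM2r ?powR_ge0 ?ler_norm.
  rewrite ler_wpM2l // ge0_ler_powR // ?nnegrE ?l1norm_ge0 //.
  by rewrite mulr_ge0.
apply: le_trans (lerD bound wT) _.
(* Here rho <= 1 enters, together with |H| < 1. *)
have sq : `[H] ^+ 2 <= `[H] `^ (1 + rho).
  have [->|H0] := eqVneq `[H] 0; first by rewrite expr0n powR_ge0.
  have Hpos : 0 < `[H] by rewrite lt_neqAle eq_sym H0.
  by rewrite -powR_mulrn // ger_powR ?Hpos ?(ltW h1) //; have := rho_le1; lra.
by have := ler_wpM2l C10 sq; rewrite powRM //; lra.
Qed.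

(** Since X + [io] h = U [s + h] V^* for every h, sorted or not, [Ex] recovers g(s + h) from G. Both
    maps are linear and bounded, so the derivative and the remainder of G carry over. *)
Lemma B_differentiable_of_spectral_operator (U : 'M[K]_m) (V : 'M[K]_n) :
  unitary S U -> unitary S V -> X = U *m diag_block S n s *m V^*h ->
  B_differentiable S G rho X -> B_differentiable RealField g rho s.
Proof.
move=> UU VV XE /(B_differentiableP S _ _ rho_gt0)[C [r [r0 Gdiff]]].
have [rN rN0 rNP] := (nbhs_l1norm S X N).1 (open_nbhs_nbhs (conj N_open NX)).
have rho1 : 0 <= 1 + rho by rewrite addr_ge0 // ltW.
pose mn2 : R := ((m * n) ^ 2)%:R; have mn20 : 0 <= mn2 by [].
pose wd := widen_ord le_mn.
pose Ex (M : 'M[K]_(m, n)) : 'cV[R]_m := \col_i re_part S ((U^*h *m M *m V) i (wd i)).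
have ExB M1 M2 : Ex (M1 - M2) = Ex M1 - Ex M2.
  apply/colP => i; rewrite [RHS]mxE [X in _ = _ + X]mxE ![Ex _ _ _]mxE.
  by rewrite -raddfB mulmxBr mulmxBl [in LHS]mxE [X in _ + X]mxE.
have ExZ t M : Ex (of_real S t *: M) = t *: Ex M.
  apply/colP => i; rewrite [RHS]mxE ![Ex _ _ _]mxE -scalemxAr -scalemxAl.
  by rewrite [X in re_part S X]mxE re_part_mul_of_real.
have Ex_le M : l1norm RealField (Ex M) <= m%:R * `[M].
  apply: col_l1norm_le => i; rewrite mxE; apply: le_trans (re_part_le_modulus _ _) _.
  by apply: unitary_mul_entry => ? ?; apply: unitary_entry => //; exact: unitary_adjoint.
have Exd y : Ex (U *m diag_block S n y *m V^*h) = y.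
  apply/colP => i; rewrite mxE !mulmxA (unitaryC UU) mul1mx -mulmxA (unitaryC VV) mulmx1.
  by rewrite diag_blockE eqxx of_realK.
pose io (h : 'cV[R]_m) := U *m diag_block S n h *m V^*h.
have ioX h : X + io h = io (s + h).
  by rewrite {1}XE /io diag_blockD mulmxDr mulmxDl.
have ioZ t h : of_real S t *: io h = io (t *: h).
  by rewrite /io diag_blockZ -scalemxAr -scalemxAl.
have io_le h : `[io h] <= mn2 * l1norm RealField h by exact: l1norm_svd_le.
have ExG h : `[io h] < rN -> Ex (G (X + io h)) = g (s + h).
  move=> hN; have NY : N (X + io h) by apply: rNP; rewrite addrAC subrr add0r.
  rewrite G_def // (@spectral_operator_svd _ _ S m n le_mn D g g_sym _ U V (s + h)) //.
  by apply: sigma_N; exists (X + io h).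
have ExGX : Ex (G X) = g s.
  have io0 : io 0 = 0 by rewrite /io (_ : diag_block S n 0 = 0) ?mulmx0 ?mul0mx // -(subrr 0) diag_blockB subrr.
  by have := ExG 0; rewrite io0 l1norm0 !addr0; apply.
apply/(B_differentiableP RealField _ _ rho_gt0).
exists (m%:R * (`|C| * mn2 `^ (1 + rho))), (Num.min rN r / (mn2 + 1)); split.
  by rewrite divr_gt0 // ?lt_min ?rN0 //; lra.
move=> h; have [T GT GTd] := Gdiff (io h); exists (Ex T).
- move=> e e0; have m1 : 0 < m%:R + 1 :> R by rewrite ltr_wpDl.
  have [d1 d10 GT1] := GT (e / (m%:R + 1)) (divr_gt0 e0 m1).
  have ih0 : 0 < `[io h] + 1 by have := l1norm_ge0 S (io h); lra.
  exists (Num.min d1 (rN / (`[io h] + 1))); first by rewrite lt_min d10 divr_gt0.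
  move=> t t0; rewrite lt_min => /andP[td1 tN].
  rewrite -![of_real RealField t]/t -ExG; last first.
    rewrite -ioZ l1normZ modulus_of_real gtr0_norm //.
    by rewrite ltr_pdivlMr in tN; lra.
  rewrite -ioZ -ExGX -ExB -ExZ -ExB.
  apply: le_trans (Ex_le _) _; have := ler_wpM2l (ler0n R m) (GT1 t t0 td1).
  move=> hl; apply: le_trans hl _; rewrite mulrA ler_wpM2r ?(ltW t0) //.
  by rewrite mulrCA ler_piMr ?(ltW e0) // ler_pdivrMr // mul1r lerDl.
move=> hr; have ih : `[io h] < Num.min rN r.
  apply: le_lt_trans (io_le _) _; rewrite ltr_pdivlMr in hr; last lra.
  by have := l1norm_ge0 RealField h; lra.
rewrite lt_min in ih; case/andP: ih => ihN ihr.
rewrite -ExG // -ExGX -!ExB; apply: le_trans (Ex_le _) _; rewrite -!mulrA ler_wpM2l //.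
apply: le_trans (GTd ihr) _.
apply: (@le_trans _ _ (`|C| * `[io h] `^ (1 + rho))).
  by rewrite ler_wpM2r ?powR_ge0 ?ler_norm.
rewrite ler_wpM2l // -powRM ?l1norm_ge0 //.
by rewrite ge0_ler_powR // ?nnegrE ?mulr_ge0 ?l1norm_ge0.
Qed.

End Main.

Theorem theorem4p1 (R : realType) (K : numFieldType) (S : real_or_complex R K)
    (m n : nat) (le_mn : (m <= n)%N)
    (N : set 'M[K]_(m, n)) (N_open : open N) (N_neq0 : N !=set0)
    (D : set 'cV[R]_m) (D_open : open D) (sigma_N : [set sigma S X | X in N] `<=` D)
    (g : 'cV[R]_m -> 'cV[R]_m) (g_sym : absolutely_symmetric D g)
    (G : 'M[K]_(m, n) -> 'M[K]_(m, n))
    (G_def : forall X, N X -> G X = spectral_operator S g X)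
    (Xbar : 'M[K]_(m, n)) (Xbar_N : N Xbar)
    (Ubar : 'M[K]_m) (Vbar : 'M[K]_n)
    (Xbar_svd : svd_pairs S Xbar (Ubar, Vbar))
    (rho : R) (rho_gt0 : 0 < rho) (rho_le1 : rho <= 1) :
  (locally_lipschitz_near RealField g (sigma S Xbar) ->
   B_differentiable RealField g rho (sigma S Xbar) ->
   B_differentiable S G rho Xbar) /\
  (B_differentiable S G rho Xbar ->
   B_differentiable RealField g rho (sigma S Xbar)).
Proof.
have [UU VV XE] := Xbar_svd; split.
  exact: (spectral_operator_B_differentiable le_mn D_open N_open Xbar_N sigma_N g_sym
    G_def rho_gt0 rho_le1).
exact: (B_differentiable_of_spectral_operator le_mn N_open Xbar_N sigma_N g_sym
  G_def rho_gt0 UU VV XE).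
Qed.
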